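(* Let $\Omega\subseteq\mathbb{R}^n$ be an open definable set and let $f\colon\Omega\to\mathbb{R}^n$ be a continuous definable mapping. Let $\overline{x}\in\Omega$ be a regular point of $f$. Then there exist scalars $r>0$ (with $\mathbb{B}_r(\overline{x})\subset\Omega$) and $\delta>0$ such that $$\|f(x')-f(x)\|\ge\delta\|x'-x\|\quad\text{for all } x,x'\in\mathbb{B}_r(\overline{x}).$$ In particular, $f(\mathbb{B}_r(\overline{x}))$ is an open set in $\mathbb{R}^n$ and the restriction $f\colon\mathbb{B}_r(\overline{x})\to f(\mathbb{B}_r(\overline{x}))$ is a homeomorphism with Lipschitz definable inverse.
   Context: Fix an o-minimal structure on $(\mathbb{R},+,\cdot)$, i.e. a sequence $(\mathcal{D}_n)_{n\in\mathbb{N}}$ such that: (a) $\mathcal{D}_n$ is a Boolean algebra of subsets of $\mathbb{R}^n$; (b) $X\in\mathcal{D}_m$, $Y\in\mathcal{D}_n$ imply $X\times Y\in\mathcal{D}_{m+n}$; (c) if $X\in\mathcal{D}_{n+1}$ then $\pi(X)\in\mathcal{D}_n$, where $\pi\colon\mathbb{R}^{n+1}\to\mathbb{R}^n$ is the projection on the first $n$ coordinates; (d) $\mathcal{D}_n$ contains all algebraic subsets of $\mathbb{R}^n$; (e) each set in $\mathcal{D}_1$ is a finite union of points and intervals. A set is definable if it belongs to some $\mathcal{D}_n$; a mapping is definable if its graph is definable. $\mathbb{B}_r(x)$ is the open Euclidean ball of center $x$ and radius $r$; $\mathrm{co}$ denotes convex hull. For $A\in\mathbb{R}^{n\times n}$,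 $\sigma(A):=\inf_{\|v\|=1}\|Av\|$. $B_f$ is the set of points of $\Omega$ at which $f$ is not of class $C^1$ (i.e. $f$ is not $C^1$ on any neighbourhood of the point); it is a definable nowhere dense set. For $x\in\Omega\setminus B_f$, $df(x)$ is the derivative of $f$ at $x$; for $U\subset\Omega$, $df(U):=\{df(x): x\in U\setminus B_f\}$. For $x\in\Omega$, $$\nu_f(x):=\lim_{r\to0^+}\ \inf_{A\in\mathrm{co}(df(\mathbb{B}_r(x)))}\sigma(A)\in[0,+\infty].$$ A point $x\in\Omega$ is a regular point of $f$ if $\nu_f(x)>0$. *)

(* Defs.v *)
From HB Require Import structures.
From mathcomp Require Import all_boot all_order all_algebra.
From mathcomp Require Import all_classical all_reals all_analysis.
(* Not imported: its notations clash with those of MathComp-Analysis. *)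
From mathcomp Require mpoly.

Set Implicit Arguments.
Unset Strict Implicit.
Unset Printing Implicit Defensive.

Import Order.TTheory GRing.Theory Num.Theory.
Import numFieldNormedType.Exports.

Local Open Scope classical_set_scope.
Local Open Scope ring_scope.

(* Points of R^n are row vectors ['rV[R]_n], so that R^m x R^n is R^(m + n)
   through [row_mx], [lsubmx] and [rsubmx]. *)

(* The library norm on matrices is the sup norm, hence this definition. On rows
   and columns it is the Euclidean norm. *)
Definition enorm (R : realType) (m n : nat) (A : 'M[R]_(m, n)) : R :=
  Num.sqrt (\sum_i \sum_j A i j ^+ 2).

Definition eball (R : realType) (n : nat) (x : 'rV[R]_n) (r : R) :
    set 'rV[R]_n :=
  [set y | enorm (y - x) < r].

Definition algebraic_set (R : realType) (n : nat) (X : set 'rV[R]_n) : Prop :=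
  exists (k : nat) (p : 'I_k -> mpoly.mpoly n R),
    X = [set x | forall j, mpoly.meval (fun i => x 0 i) (p j) = 0].

Record o_minimal (R : realType) (D : forall n, set (set 'rV[R]_n)) : Prop := {
  omin_set0 : forall n, D n set0;
  omin_setC : forall n X, D n X -> D n (~` X);
  omin_setU : forall n X Y, D n X -> D n Y -> D n (X `|` Y);
  omin_setX : forall m n (X : set 'rV[R]_m) (Y : set 'rV[R]_n),
    D m X -> D n Y -> D (m + n)%N [set z | X (lsubmx z) /\ Y (rsubmx z)];
  omin_proj : forall n (X : set 'rV[R]_(n + 1)),
    D (n + 1)%N X -> D n [set lsubmx z | z in X];
  omin_algebraic : forall n (X : set 'rV[R]_n), algebraic_set X -> D n X;
  omin_dim1 : forall X : set 'rV[R]_1, D 1%N X ->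
    exists (P : seq R) (I : seq (interval R)),
      X = [set x | x 0 0 \in P \/ exists2 J, J \in I & x 0 0 \in J] }.

(* Maps with domain a subset A of R^m are total functions of which only the
   values on A matter; the graph is therefore taken over A. *)
Definition definable_map (R : realType) (D : forall n, set (set 'rV[R]_n))
    (m n : nat) (A : set 'rV[R]_m) (f : 'rV[R]_m -> 'rV[R]_n) : Prop :=
  D (m + n)%N [set row_mx x (f x) | x in A].

(* The library Jacobian acts on row vectors on the right; its transpose is the
   usual matrix of partial derivatives, acting on column vectors. *)
Definition deriv_mx (R : realType) (n : nat) (f : 'rV[R]_n -> 'rV[R]_n)
    (x : 'rV[R]_n) : 'M[R]_n :=
  (jacobian f x)^T.

Definition C1_near (R : realType) (n : nat) (f : 'rV[R]_n -> 'rV[R]_n)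
    (x : 'rV[R]_n) : Prop :=
  exists U : set 'rV[R]_n, [/\ open U, U x,
    forall y, U y -> differentiable f y &
    forall y, U y -> {for y, continuous (deriv_mx f)}].

Definition nonC1 (R : realType) (n : nat) (Omega : set 'rV[R]_n)
    (f : 'rV[R]_n -> 'rV[R]_n) : set 'rV[R]_n :=
  [set x | Omega x /\ ~ C1_near f x].

Definition deriv_image (R : realType) (n : nat) (Omega : set 'rV[R]_n)
    (f : 'rV[R]_n -> 'rV[R]_n) (U : set 'rV[R]_n) : set 'M[R]_n :=
  [set deriv_mx f x | x in (U `&` Omega) `\` nonC1 Omega f].

Definition conv_hull (R : realType) (E : lmodType R) (A : set E) : set E :=
  smallest (@convex_set R E) A.

Definition sigma_min (R : realType) (n : nat) (A : 'M[R]_n) : \bar R :=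
  ereal_inf [set (enorm (A *m v))%:E | v in [set v : 'cV[R]_n | enorm v = 1]].

Definition nu (R : realType) (n : nat) (Omega : set 'rV[R]_n)
    (f : 'rV[R]_n -> 'rV[R]_n) (x : 'rV[R]_n) : \bar R :=
  lim ((fun r : R => ereal_inf
    [set sigma_min A | A in conv_hull (deriv_image Omega f (eball x r))])
      @ 0^'+).

Definition regular_point (R : realType) (n : nat) (Omega : set 'rV[R]_n)
    (f : 'rV[R]_n -> 'rV[R]_n) (x : 'rV[R]_n) : Prop :=
  Omega x /\ (0 < nu Omega f x)%E.

(* [f] restricts to a homeomorphism from [A] onto [B], with inverse [g]. *)
Definition homeomorphism_with_inverse (R : realType) (m n : nat)
    (A : set 'rV[R]_m) (B : set 'rV[R]_n)
    (f : 'rV[R]_m -> 'rV[R]_n) (g : 'rV[R]_n -> 'rV[R]_m) : Prop :=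
  [/\ set_bij A B f, forall x, A x -> g (f x) = x,
    {within A, continuous f} & {within B, continuous g}].

Definition elipschitz_on (R : realType) (m n : nat) (A : set 'rV[R]_m)
    (f : 'rV[R]_m -> 'rV[R]_n) : Prop :=
  exists L : R, forall x y, A x -> A y -> enorm (f x - f y) <= L * enorm (x - y).

(* Main.v *)
(* Cell decomposition is replaced by Baire's theorem. By induction on the
   dimension, every definable set has, in each nonempty open set, a point near
   which it is everything or nothing; by Baire, one point does this for
   countably many definable sets at once. Applied to sublevel sets and to sets
   of points where right slopes exceed a rational, this shows that a continuous
   definable map is C^1 at some point of every nonempty open set, and that if
   <u, Df(y) v> >= c at all C^1 points y of a ball then
   <u, f(x + tv) - f(x)> >= c t there: otherwise the right slope of <u, f> along
   v would be less than some p < c on an open set, which contains a C^1 point.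

   The convex hull of df(B) being at distance delta from the singular matrices,
   separation gives for every unit v a unit u with <u, A v> >= delta on it, hence
   the lower Lipschitz bound; applied to the transposes, it gives for every unit
   u such a v.

   Openness does not use invariance of domain. Minimizing |f - y| on a closed
   ball fails because f need not be Lipschitz, so f is replaced by averages F of
   finitely many small translates. They satisfy the same growth inequalities and
   are Lipschitz above an arbitrarily small scale. At a minimizer of |F - y|,
   moving along the v associated with u = (F - y) / |F - y| would decrease
   |F - y|, unless it is small; in the limit f attains the value y. *)

Require Import Defs.
From HB Require Import structures.
From mathcomp Require Import all_boot all_order all_algebra.
From mathcomp Require Import all_classical all_reals all_analysis.
From mathcomp Require Import ring lra.
From mathcomp Require mpoly.
Import (canonicals) mpoly.

Set Implicit Arguments.
Unset Strict Implicit.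
Unset Printing Implicit Defensive.

Import Order.TTheory GRing.Theory Num.Theory.
Import numFieldNormedType.Exports.

Local Open Scope classical_set_scope.
Local Open Scope ring_scope.

(** * Definable sets and maps *)

(** Growth is recorded as [delta * t <= <u, f (x + t v) - f x>] because this puts each increment in
    a half-space, which means of increments do not leave; the bound
    [delta * |x' - x| <= |f x' - f x|] alone would not survive averaging. Separation is used in both
    orders: a unit [u] for each [v] gives the lower Lipschitz bound, and a unit [v] for each [u]
    tells in which direction to move in order to correct an error along [u].

    The correction compares orders of magnitude. A move of length [t] gains a multiple of [t] in the
    squared distance to [y] and loses the square of the increment, which must therefore be O(t^2);
    continuity of [f] does not give this. The averages satisfy [|F (x + h) - F x| <= L * t] for
    [|h| <= t], where [L] depends on the required closeness of [F] to [f] but not on [t]. So [t] is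
    chosen after [L], and the number of translates after [t].

    Sets are shown definable by reading off a first-order formula over the reals; hence the
    epsilon-delta form of the notions of continuity and derivative. *)

Section Definability.
Variables (R : realType) (D : forall n, set (set 'rV[R]_n)).
Arguments D : clear implicits.
Hypothesis hD : o_minimal D.

Lemma definable_setT n : D n setT.
Proof. by rewrite -setC0; apply: omin_setC => //; apply: omin_set0. Qed.

Lemma definable_and n (P Q : 'rV[R]_n -> Prop) :
  D n [set x | P x] -> D n [set x | Q x] -> D n [set x | P x /\ Q x].
Proof.
move=> dP dQ.
have -> : [set x | P x /\ Q x] = ~` (~` [set x | P x] `|` ~` [set x | Q x]).
  by rewrite setCU !setCK.
by apply: omin_setC => //; apply: omin_setU => //; apply: omin_setC.
Qed.

Lemma definable_or n (P Q : 'rV[R]_n -> Prop) :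
  D n [set x | P x] -> D n [set x | Q x] -> D n [set x | P x \/ Q x].
Proof. exact: omin_setU. Qed.

Lemma definable_not n (P : 'rV[R]_n -> Prop) :
  D n [set x | P x] -> D n [set x | ~ P x].
Proof. exact: omin_setC. Qed.

Lemma definable_impl n (P Q : 'rV[R]_n -> Prop) :
  D n [set x | P x] -> D n [set x | Q x] -> D n [set x | P x -> Q x].
Proof.
move=> dP dQ; have -> : [set x | P x -> Q x] = [set x | ~ P x \/ Q x].
  by apply/seteqP; split => x /= => [h|[]//]; have [/h|] := pselect (P x); [right|left].
by apply: definable_or => //; apply: definable_not.
Qed.

Lemma definable_all_ord n k (P : 'I_k -> 'rV[R]_n -> Prop) :
  (forall j, D n [set x | P j x]) -> D n [set x | forall j, P j x].
Proof.
move=> dP.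
have -> : [set x | forall j, P j x] = [set x | forall j, j \in enum 'I_k -> P j x].
  by apply/seteqP; split => x /= h j //; apply: h; rewrite mem_enum.
elim: (enum 'I_k) => [|a s IH].
  by have -> : [set x | forall j, j \in [::] -> P j x] = setT;
    [apply/seteqP; split|exact: definable_setT].
have -> : [set x | forall j, j \in a :: s -> P j x] =
   [set x | P a x /\ forall j, j \in s -> P j x].
  apply/seteqP; split => x /= h.
    by split=> [|j js]; apply: h; rewrite inE ?eqxx// js orbT.
  by move=> j; rewrite inE => /orP[/eqP->|]; [exact: h.1|exact: h.2].
exact: definable_and.
Qed.

Lemma definable_cast m n (e : m = n) (X : set 'rV[R]_n) :
  D n X -> D m [set x | X (castmx (erefl, e) x)].
Proof. by case: n / e X => X; under eq_set do rewrite castmx_id. Qed.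

Lemma definable_proj k n (X : set 'rV[R]_(n + k)) :
  D (n + k)%N X -> D n [set lsubmx z | z in X].
Proof.
elim: k X => [|k IH] X dX.
  have e : n = (n + 0)%N by rewrite addn0.
  have := definable_cast e dX; congr (D n _); apply/seteqP; split => x /= => [h|[z Xz <-]].
    exists (castmx (erefl, e) x) => //; apply/rowP => j; rewrite mxE castmxE.
    by congr (x _ _); apply: val_inj.
  congr (X _): Xz; apply/rowP => j; rewrite castmxE mxE.
  by congr (z _ _); apply: val_inj.
have e : (n + k + 1 = n + k.+1)%N by rewrite -addnA addn1.
have := IH _ (omin_proj hD (definable_cast e dX)).
congr (D n _); apply/seteqP; split => x /=.
  move=> [y [z Xz <-] <-]; exists (castmx (erefl, e) z) => //.
  apply/rowP => j; rewrite !mxE castmxE.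
  by congr (z _ _); apply: val_inj.
move=> [z Xz <-]; exists (lsubmx (castmx (erefl, esym e) z)).
  exists (castmx (erefl, esym e) z) => //.
  by rewrite castmx_comp castmx_id.
apply/rowP => j; rewrite !mxE castmxE.
by congr (z _ _); apply: val_inj.
Qed.

Lemma definable_ex n k (P : 'rV[R]_n -> 'rV[R]_k -> Prop) :
  D (n + k)%N [set z | P (lsubmx z) (rsubmx z)] -> D n [set x | exists y, P x y].
Proof.
move=> /definable_proj; congr (D n _); apply/seteqP; split => x /=.
  by move=> [z Pz <-]; exists (rsubmx z).
by move=> [y Py]; exists (row_mx x y); rewrite ?row_mxKl ?row_mxKr.
Qed.

Lemma definable_all n k (P : 'rV[R]_n -> 'rV[R]_k -> Prop) :
  D (n + k)%N [set z | P (lsubmx z) (rsubmx z)] -> D n [set x | forall y, P x y].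
Proof.
move=> /definable_not/(@definable_ex _ _ (fun x y => ~ P x y))/definable_not.
congr (D n _); apply/seteqP; split => x /= => [h y|h [y]]; last exact.
by apply: contrapT => nP; apply: h; exists y.
Qed.

Lemma definable_exR n (P : 'rV[R]_n -> R -> Prop) :
  D (n + 1)%N [set z | P (lsubmx z) (rsubmx z 0 0)] -> D n [set x | exists t, P x t].
Proof.
move=> /(@definable_ex _ _ (fun x y => P x (y 0 0))).
congr (D n _); apply/seteqP; split => x /=.
  by move=> [y Py]; exists (y 0 0).
by move=> [t Pt]; exists (\row__ t); rewrite mxE.
Qed.

Lemma definable_allR n (P : 'rV[R]_n -> R -> Prop) :
  D (n + 1)%N [set z | P (lsubmx z) (rsubmx z 0 0)] -> D n [set x | forall t, P x t].
Proof.
move=> /definable_not/(@definable_exR _ (fun x y => ~ P x y))/definable_not.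
congr (D n _); apply/seteqP; split => x /= => [h y|h [y]]; last exact.
by apply: contrapT => nP; apply: h; exists y.
Qed.

Definition polynomial_fun n (h : 'rV[R]_n -> R) :=
  exists p : mpoly.mpoly n R, forall x, h x = mpoly.meval (fun i => x 0 i) p.

Lemma polynomial_coord n (i : 'I_n) : polynomial_fun (fun x => x 0 i).
Proof. by exists (mpoly.mpolyX R (mpoly.mnm1 i)) => x; rewrite mpoly.mevalXU. Qed.

Lemma polynomial_cst n c : polynomial_fun (fun _ : 'rV[R]_n => c).
Proof. by exists (mpoly.mpolyC n c) => x; rewrite mpoly.mevalC. Qed.

Lemma polynomialD n (h k : 'rV[R]_n -> R) :
  polynomial_fun h -> polynomial_fun k -> polynomial_fun (fun x => h x + k x).
Proof. by move=> [p hp] [q hq]; exists (p + q) => x; rewrite mpoly.mevalD hp hq. Qed.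

Lemma polynomialM n (h k : 'rV[R]_n -> R) :
  polynomial_fun h -> polynomial_fun k -> polynomial_fun (fun x => h x * k x).
Proof. by move=> [p hp] [q hq]; exists (p * q) => x; rewrite mpoly.mevalM hp hq. Qed.

Lemma polynomialB n (h k : 'rV[R]_n -> R) :
  polynomial_fun h -> polynomial_fun k -> polynomial_fun (fun x => h x - k x).
Proof. by move=> [p hp] [q hq]; exists (p - q) => x; rewrite mpoly.mevalB hp hq. Qed.

Lemma definable_polynomial_eq n (h k : 'rV[R]_n -> R) :
  polynomial_fun h -> polynomial_fun k -> D n [set x | h x = k x].
Proof.
move=> hh hk; have [p hp] := polynomialB hh hk.
apply: (omin_algebraic hD); exists 1%N, (fun _ => p).
apply/seteqP; split => x /=; first by move=> e _; rewrite -hp e subrr.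
by move/(_ ord0); rewrite -hp => /eqP; rewrite subr_eq0 => /eqP.
Qed.

(** The preimage is a projection of the intersection of the graph of [L], which is algebraic, with
    the cylinder over [Y]. Linear maps include every selection, repetition and permutation of
    coordinates, and this is how variables of formulas are rearranged. *)
Lemma definable_linear_preim m n (L : 'rV[R]_m -> 'rV[R]_n) (Y : set 'rV[R]_n) :
  linear L -> D n Y -> D m [set x | Y (L x)].
Proof.
move=> linL dY.
pose LL : {linear 'rV[R]_m -> 'rV[R]_n} :=
  HB.pack L (GRing.isLinear.Build _ _ _ _ L linL).
have LE x : L x = x *m lin1_mx LL by rewrite (mul_rV_lin1 LL).
have -> : [set x | Y (L x)] =
    [set x : 'rV[R]_m | exists y : 'rV[R]_n, (forall j, y 0 j = \sum_i x 0 i * lin1_mx LL i j) /\ Y y].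
  apply/seteqP; split => x /=.
    by move=> YLx; exists (L x); split=> // j; rewrite LE mxE.
  move=> [y [yE Yy]]; suff -> : L x = y by [].
  by apply/rowP => j; rewrite LE mxE yE.
apply: definable_ex; apply: definable_and; last first.
  have := omin_setX hD (definable_setT m) dY; congr (D _ _).
  by apply/seteqP; split => x //= -[].
apply: definable_all_ord => j; apply: definable_polynomial_eq.
  by under eq_fun do rewrite mxE; exact: polynomial_coord.
have pj i : polynomial_fun (fun z : 'rV[R]_(m + n) => lsubmx z 0 i * lin1_mx LL i j).
  apply: polynomialM; last exact: polynomial_cst.
  by under eq_fun do rewrite mxE; exact: polynomial_coord.
elim: (index_enum _) => [|i s IH].
  by under eq_fun do rewrite big_nil; exact: polynomial_cst.
by under eq_fun do rewrite big_cons; exact: polynomialD.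
Qed.

(** The graph is a formula in the two halves of a row, with no bound variable, so that it can be
    substituted into other formulas. This asks for a map on the whole space; partial maps are first
    extended. *)
Definition definable_tmap m n (h : 'rV[R]_m -> 'rV[R]_n) :=
  D (m + n)%N [set z | rsubmx z = h (lsubmx z)].

Definition definable_fun n (h : 'rV[R]_n -> R) :=
  D (n + 1)%N [set z | rsubmx z 0 0 = h (lsubmx z)].

Lemma linear_row_mx m n k (L : 'rV[R]_m -> 'rV[R]_n) (M : 'rV[R]_m -> 'rV[R]_k) :
  linear L -> linear M -> linear (fun z => row_mx (L z) (M z)).
Proof. by move=> hL hM a x y; rewrite hL hM scale_row_mx add_row_mx. Qed.

Lemma linear_lsub_comp m n k (L : 'rV[R]_m -> 'rV[R]_(n + k)) :
  linear L -> linear (fun z => lsubmx (L z)).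
Proof. by move=> hL a x y; rewrite hL linearP. Qed.

Lemma linear_rsub_comp m n k (L : 'rV[R]_m -> 'rV[R]_(n + k)) :
  linear L -> linear (fun z => rsubmx (L z)).
Proof. by move=> hL a x y; rewrite hL linearP. Qed.

Lemma linear_idfun m : linear (fun z : 'rV[R]_m => z).
Proof. by []. Qed.

Lemma linear_row1 m n (L : 'rV[R]_m -> 'rV[R]_n) j :
  linear L -> linear (fun z => \row_(_ < 1) L z 0 j).
Proof. by move=> hL a x y; apply/rowP => i; rewrite !mxE hL !mxE. Qed.

Ltac linear_map := repeat first
  [ exact: linear_idfun | apply: linear_row_mx | apply: linear_row1
  | apply: linear_lsub_comp | apply: linear_rsub_comp ].

Lemma definable_polynomial_fun n (h : 'rV[R]_n -> R) :
  polynomial_fun h -> definable_fun h.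
Proof.
move=> [p hp]; apply: definable_polynomial_eq.
  by under eq_fun do rewrite mxE; exact: polynomial_coord.
exists (mpoly.comp_mpoly [tuple mpoly.mpolyX R (mpoly.mnm1 (lshift 1 i)) | i < n] p) => x.
rewrite hp mpoly.comp_mpoly_meval; congr mpoly.meval; apply/funext => i.
by rewrite tnth_mktuple mpoly.mevalXU mxE.
Qed.

Lemma definable_tmapP m n (h : 'rV[R]_m -> 'rV[R]_n) :
  (forall j, definable_fun (fun x => h x 0 j)) -> definable_tmap h.
Proof.
move=> dh; rewrite /definable_tmap.
have -> : [set z | rsubmx z = h (lsubmx z)] =
    [set z | forall j, rsubmx z 0 j = h (lsubmx z) 0 j].
  by apply/seteqP; split => z /= => [->//|e]; apply/rowP.
apply: definable_all_ord => j.
have := @definable_linear_preim _ _ (fun z : 'rV[R]_(m + n) =>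
  row_mx (lsubmx z) (\row_(_ < 1) rsubmx z 0 j)) _ _ (dh j).
under eq_set do rewrite /= row_mxKl row_mxKr mxE.
by apply; linear_map.
Qed.

Lemma definable_preim m n (h : 'rV[R]_m -> 'rV[R]_n) (Y : set 'rV[R]_n) :
  definable_tmap h -> D n Y -> D m [set x | Y (h x)].
Proof.
move=> dh dY; have -> : [set x | Y (h x)] = [set x | exists y, y = h x /\ Y y].
  by apply/seteqP; split => x /= => [Yx|[y [->]]//]; exists (h x).
apply: definable_ex; apply: definable_and => //.
by apply: (definable_linear_preim (L := rsubmx)) => //; linear_map.
Qed.

Lemma definable_tmap_comp m n k (g : 'rV[R]_n -> 'rV[R]_k) (h : 'rV[R]_m -> 'rV[R]_n) :
  definable_tmap g -> definable_tmap h -> definable_tmap (fun x => g (h x)).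
Proof.
move=> dg dh; rewrite /definable_tmap.
have -> : [set z | rsubmx z = g (h (lsubmx z))] =
    [set z : 'rV_(m + k) | exists y, y = h (lsubmx z) /\ rsubmx z = g y].
  by apply/seteqP; split => x /= => [|[y [->]]//]; exists (h (lsubmx x)).
apply: definable_ex; apply: definable_and.
  have := @definable_linear_preim _ _ (fun z : 'rV[R]_(m + k + n) =>
    row_mx (lsubmx (lsubmx z)) (rsubmx z)) _ _ dh.
  under eq_set do rewrite /= row_mxKl row_mxKr.
  by apply; linear_map.
have := @definable_linear_preim _ _ (fun z : 'rV[R]_(m + k + n) =>
  row_mx (rsubmx z) (rsubmx (lsubmx z))) _ _ dg.
under eq_set do rewrite /= row_mxKl row_mxKr.
by apply; linear_map.
Qed.

Lemma definable_fun_tmap n (h : 'rV[R]_n -> R) :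
  definable_fun h <-> definable_tmap (fun x => \row_(_ < 1) h x).
Proof.
rewrite /definable_fun /definable_tmap.
suff -> : [set z : 'rV_(n + 1) | rsubmx z 0 0 = h (lsubmx z)] =
   [set z | rsubmx z = \row__ h (lsubmx z)] by [].
apply/seteqP; split => z /= e; last by rewrite e mxE.
by apply/rowP => j; rewrite ord1 e mxE.
Qed.

Lemma definable_fun_comp m n (g : 'rV[R]_n -> R) (h : 'rV[R]_m -> 'rV[R]_n) :
  definable_fun g -> definable_tmap h -> definable_fun (fun x => g (h x)).
Proof.
by move=> /definable_fun_tmap dg dh; apply/definable_fun_tmap/(definable_tmap_comp dg).
Qed.

Lemma definable_fun_coord m n (h : 'rV[R]_m -> 'rV[R]_n) j :
  definable_tmap h -> definable_fun (fun x => h x 0 j).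
Proof.
move=> dh; apply: (definable_fun_comp (g := fun x => x 0 j)) => //.
exact/definable_polynomial_fun/polynomial_coord.
Qed.

Lemma definable_tmap_row_mx m n k (g : 'rV[R]_m -> 'rV[R]_n) (h : 'rV[R]_m -> 'rV[R]_k) :
  definable_tmap g -> definable_tmap h -> definable_tmap (fun x => row_mx (g x) (h x)).
Proof.
move=> dg dh; apply: definable_tmapP => j.
case: (split_ordP j) => i ->.
  by under eq_fun do rewrite row_mxEl; exact: definable_fun_coord.
by under eq_fun do rewrite row_mxEr; exact: definable_fun_coord.
Qed.

Lemma definable_fun_op2 n (F : R -> R -> R) (h k : 'rV[R]_n -> R) :
  polynomial_fun (fun z : 'rV[R]_(1 + 1) => F (z 0 (lshift 1 0)) (z 0 (rshift 1 0))) ->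
  definable_fun h -> definable_fun k -> definable_fun (fun x => F (h x) (k x)).
Proof.
move=> pF /definable_fun_tmap dh /definable_fun_tmap dk.
have := definable_fun_comp (definable_polynomial_fun pF) (definable_tmap_row_mx dh dk).
by under eq_fun do rewrite row_mxEl row_mxEr !mxE.
Qed.

Lemma definable_funD n (h k : 'rV[R]_n -> R) :
  definable_fun h -> definable_fun k -> definable_fun (fun x => h x + k x).
Proof.
by apply: (definable_fun_op2 (F := +%R)); apply: polynomialD; apply: polynomial_coord.
Qed.

Lemma definable_funB n (h k : 'rV[R]_n -> R) :
  definable_fun h -> definable_fun k -> definable_fun (fun x => h x - k x).
Proof.
apply: (definable_fun_op2 (F := fun x y => x - y)).
by apply: polynomialB; apply: polynomial_coord.
Qed.

Lemma definable_funM n (h k : 'rV[R]_n -> R) :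
  definable_fun h -> definable_fun k -> definable_fun (fun x => h x * k x).
Proof.
by apply: (definable_fun_op2 (F := *%R)); apply: polynomialM; apply: polynomial_coord.
Qed.

Lemma definable_fun_cst n (c : R) : definable_fun (fun _ : 'rV[R]_n => c).
Proof. exact/definable_polynomial_fun/polynomial_cst. Qed.

Lemma definable_fun_sum n k (F : 'I_k -> 'rV[R]_n -> R) :
  (forall i, definable_fun (F i)) -> definable_fun (fun x => \sum_i F i x).
Proof.
move=> dF; elim: (index_enum _) => [|i s IH].
  by under eq_fun do rewrite big_nil; exact: definable_fun_cst.
by under eq_fun do rewrite big_cons; exact: definable_funD.
Qed.

Lemma definable_eq n (h k : 'rV[R]_n -> R) :
  definable_fun h -> definable_fun k -> D n [set x | h x = k x].
Proof.
move=> /definable_fun_tmap dh /definable_fun_tmap dk.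
have dE : D (1 + 1)%N [set z : 'rV[R]_(1 + 1) | z 0 (lshift 1 0) = z 0 (rshift 1 0)].
  by apply: definable_polynomial_eq; exact: polynomial_coord.
have := definable_preim (definable_tmap_row_mx dh dk) dE; congr (D n _).
by apply/seteqP; split => x /=; rewrite row_mxEl row_mxEr !mxE.
Qed.

Lemma definable_tmap_id n : definable_tmap (fun x : 'rV[R]_n => x).
Proof. by apply: definable_tmapP => j; exact/definable_polynomial_fun/polynomial_coord. Qed.

Lemma definable_tmap_linear m n (L : 'rV[R]_m -> 'rV[R]_n) :
  linear L -> definable_tmap L.
Proof.
move=> linL; have := @definable_linear_preim _ _ (fun z : 'rV[R]_(m + n) =>
  row_mx (L (lsubmx z)) (rsubmx z)) [set z | rsubmx z = lsubmx z].
rewrite /definable_tmap.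
have -> : [set z | rsubmx z = L (lsubmx z)] =
  [set x | [set z | rsubmx z = lsubmx z] (row_mx (L (lsubmx x)) (rsubmx x))].
  by apply/seteqP; split => z /=; rewrite row_mxKl row_mxKr.
apply; last exact: definable_tmap_id.
by move=> a x y; rewrite !linearP linL scale_row_mx add_row_mx.
Qed.

Lemma definable_tmap_lsub m n k (L : 'rV[R]_m -> 'rV[R]_(n + k)) :
  definable_tmap L -> definable_tmap (fun z => lsubmx (L z)).
Proof. by apply: definable_tmap_comp; apply: definable_tmap_linear; linear_map. Qed.

Lemma definable_tmap_rsub m n k (L : 'rV[R]_m -> 'rV[R]_(n + k)) :
  definable_tmap L -> definable_tmap (fun z => rsubmx (L z)).
Proof. by apply: definable_tmap_comp; apply: definable_tmap_linear; linear_map. Qed.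

Lemma definable_tmapD m n (g h : 'rV[R]_m -> 'rV[R]_n) :
  definable_tmap g -> definable_tmap h -> definable_tmap (fun x => g x + h x).
Proof.
move=> dg dh; apply: definable_tmapP => j; under eq_fun do rewrite mxE.
by apply: definable_funD; apply: definable_fun_coord.
Qed.

Lemma definable_funN n (h : 'rV[R]_n -> R) :
  definable_fun h -> definable_fun (fun x => - h x).
Proof.
by move=> dh; under eq_fun do rewrite -sub0r; apply: definable_funB => //; exact: definable_fun_cst.
Qed.

Lemma definable_tmapN m n (g : 'rV[R]_m -> 'rV[R]_n) :
  definable_tmap g -> definable_tmap (fun x => - g x).
Proof.
move=> dg; apply: definable_tmapP => j; under eq_fun do rewrite mxE.
by apply: definable_funN; apply: definable_fun_coord.
Qed.

Lemma definable_tmapZ m n (t : 'rV[R]_m -> R) (h : 'rV[R]_m -> 'rV[R]_n) :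
  definable_fun t -> definable_tmap h -> definable_tmap (fun x => t x *: h x).
Proof.
move=> dt dh; apply: definable_tmapP => j; under eq_fun do rewrite mxE.
by apply: definable_funM => //; apply: definable_fun_coord.
Qed.

Lemma definable_tmap_cst m n (c : 'rV[R]_n) : definable_tmap (fun _ : 'rV[R]_m => c).
Proof. by apply: definable_tmapP => j; apply: definable_fun_cst. Qed.

(** The order is recovered from the algebraic sets: a real [a] is positive exactly when
    [a * t ^+ 2 = 1] has a solution [t], and solvability is a projection. *)
Lemma definable_lt n (h k : 'rV[R]_n -> R) :
  definable_fun h -> definable_fun k -> D n [set x | h x < k x].
Proof.
move=> dh dk.
have -> : [set x | h x < k x] = [set x | exists t, (k x - h x) * (t * t) = 1].
  apply/seteqP; split => x /=; rewrite -subr_gt0.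
    move=> lt0; exists (Num.sqrt (k x - h x)^-1).
    by rewrite -expr2 sqr_sqrtr ?mulfV ?gt_eqF// invr_ge0 ltW.
  move=> [t e]; rewrite ltNge; apply/negP => le0.
  have : (k x - h x) * (t * t) <= 0 by rewrite mulr_le0_ge0// -expr2 sqr_ge0.
  by rewrite e ler10.
apply: definable_exR; apply: definable_eq; last exact: definable_fun_cst.
have dt : definable_fun (fun z : 'rV[R]_(n + 1) => rsubmx z 0 0).
  exact/definable_fun_coord/definable_tmap_rsub/definable_tmap_id.
have dl := definable_tmap_lsub (definable_tmap_id (n + 1)).
apply: definable_funM; last exact: definable_funM.
by apply: definable_funB; [have := definable_fun_comp dk dl|have := definable_fun_comp dh dl].
Qed.

Lemma definable_le n (h k : 'rV[R]_n -> R) :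
  definable_fun h -> definable_fun k -> D n [set x | h x <= k x].
Proof.
move=> dh dk; have := definable_not (definable_lt dk dh); congr (D n _).
by apply/seteqP; split => x /=; rewrite leNgt => /negP.
Qed.

Lemma definable_fun_norm n (h : 'rV[R]_n -> R) :
  definable_fun h -> definable_fun (fun x => `|h x|).
Proof.
move=> dh; rewrite /definable_fun.
have -> : [set z : 'rV[R]_(n + 1) | rsubmx z 0 0 = `|h (lsubmx z)|] =
    [set z | 0 <= rsubmx z 0 0 /\
      rsubmx z 0 0 * rsubmx z 0 0 = h (lsubmx z) * h (lsubmx z)].
  apply/seteqP; split => z /=.
    by move=> ->; rewrite -!expr2 real_normK ?num_real.
  by move=> [z0]; rewrite -!expr2 -sqrtr_sqr => <-; rewrite sqrtr_sqr ger0_norm.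
have dr := definable_fun_coord 0 (definable_tmap_rsub (definable_tmap_id (n + 1))).
have dl := definable_fun_comp dh (definable_tmap_lsub (definable_tmap_id (n + 1))).
apply: definable_and; first by apply: definable_le => //; exact: definable_fun_cst.
by apply: definable_eq; apply: definable_funM.
Qed.

Lemma definable_fun_enorm m n (h : 'rV[R]_m -> 'rV[R]_n) :
  definable_tmap h -> definable_fun (fun x => enorm (h x)).
Proof.
move=> dh; rewrite /definable_fun.
have -> : [set z : 'rV[R]_(m + 1) | rsubmx z 0 0 = enorm (h (lsubmx z))] =
    [set z | 0 <= rsubmx z 0 0 /\ rsubmx z 0 0 * rsubmx z 0 0 =
      \sum_i h (lsubmx z) 0 i * h (lsubmx z) 0 i].
  apply/seteqP; split => z; rewrite /= /enorm big_ord1 => h1.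
    rewrite h1 -expr2 sqr_sqrtr ?sqrtr_ge0//; last by apply: sumr_ge0 => i _; exact: sqr_ge0.
  rewrite (eq_bigr (fun i => h (lsubmx z) 0 i * h (lsubmx z) 0 i)) => [|i _]; last exact: expr2.
  by rewrite -h1.2 -expr2 sqrtr_sqr ger0_norm// h1.1.
have dr := definable_fun_coord 0 (definable_tmap_rsub (definable_tmap_id (m + 1))).
have dl := definable_tmap_comp dh (definable_tmap_lsub (definable_tmap_id (m + 1))).
apply: definable_and; first by apply: definable_le => //; exact: definable_fun_cst.
apply: definable_eq; first exact: definable_funM.
by apply: definable_fun_sum => i; apply: definable_funM; exact: definable_fun_coord.
Qed.

End Definability.

(** Closure under first-order formulas: each clause removes the outermost connective, quantifier or
    operation, and the hypotheses supply the atoms. Quantifiers over indices and over rows are tried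
    before the clauses with an arbitrary type, which stand for quantifiers over the reals. Only
    [exists] with [/\] is recognized, so definitions meant for this tactic avoid [exists2]. *)
Ltac definability hD := repeat (cbv beta; match goal with
  | H : ?P |- ?P => exact: H
  | |- _ [set x | @?P x /\ @?Q x] => apply: (definable_and hD)
  | |- _ [set x | @?P x \/ @?Q x] => apply: (definable_or hD)
  | |- _ [set x | ~ (@?P x)] => apply: (definable_not hD)
  | |- _ [set x | @?P x -> @?Q x] => apply: (definable_impl hD)
  | |- _ [set x | forall t : 'I_ _, @?P x t] => apply: (definable_all_ord hD) => ?
  | |- _ [set x | forall t : 'rV_ _, @?P x t] => apply: (definable_all hD)
  | |- _ [set x | exists t : 'rV_ _, @?P x t] => apply: (definable_ex hD)
  | |- _ [set x | forall t : _, @?P x t] => apply: (definable_allR hD)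
  | |- _ [set x | exists t : _, @?P x t] => apply: (definable_exR hD)
  | |- _ [set x | is_true (@?h x < @?k x)%R] => apply: (definable_lt hD)
  | |- _ [set x | is_true (@?h x <= @?k x)%R] => apply: (definable_le hD)
  | |- _ [set x | @?h x = @?k x] => apply: (definable_eq hD)
  | |- definable_fun _ (fun _ => ?c) => exact: (definable_fun_cst hD)
  | |- definable_fun _ (fun x => (@?h x + @?k x)%R) => apply: (definable_funD hD)
  | |- definable_fun _ (fun x => (@?h x * @?k x)%R) => apply: (definable_funM hD)
  | |- definable_fun _ (fun x => (- @?k x)%R) => apply: (definable_funN hD)
  | |- definable_fun _ (fun x => fun_of_matrix (@?h x) _ _) => apply: (definable_fun_coord hD)
  | |- definable_fun _ (fun x => enorm (@?h x)) => apply: (definable_fun_enorm hD)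
  | |- definable_fun _ (fun x => `|@?h x|%R) => apply: (definable_fun_norm hD)
  | |- definable_tmap _ (fun x => x) => exact: (definable_tmap_id hD)
  | |- definable_tmap _ (fun _ => ?c) => exact: (definable_tmap_cst hD)
  | |- definable_tmap _ (@lsubmx _ _ _ _) => exact: (definable_tmap_lsub hD (definable_tmap_id hD _))
  | |- definable_tmap _ (@rsubmx _ _ _ _) => exact: (definable_tmap_rsub hD (definable_tmap_id hD _))
  | |- definable_tmap _ (fun x => lsubmx (@?h x)) => apply: (definable_tmap_lsub hD)
  | |- definable_tmap _ (fun x => rsubmx (@?h x)) => apply: (definable_tmap_rsub hD)
  | |- definable_tmap _ (fun x => (@?h x + @?k x)%R) => apply: (definable_tmapD hD)
  | |- definable_tmap _ (fun x => (- @?k x)%R) => apply: (definable_tmapN hD)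
  | |- definable_tmap _ (fun x => (@?h x *: @?k x)%R) => apply: (definable_tmapZ hD)
  | |- definable_tmap _ (fun x => row_mx (@?h x) (@?k x)) => apply: (definable_tmap_row_mx hD)
  | H : definable_fun _ ?h |- definable_fun _ (fun x => ?h (@?k x)) =>
      apply: (definable_fun_comp hD H)
  | H : definable_tmap _ ?h |- definable_tmap _ (fun x => ?h (@?k x)) =>
      apply: (definable_tmap_comp hD H)
  end).

(** * The Euclidean norm *)

Section EuclideanNorm.
Variables (R : realType) (n : nat).
Implicit Types (u v x y z : 'rV[R]_n).

Definition dot u v : R := \sum_i u 0 i * v 0 i.

Lemma dotC u v : dot u v = dot v u.
Proof. by apply: eq_bigr => i _; rewrite mulrC. Qed.

Lemma dotDl u v w : dot (u + v) w = dot u w + dot v w.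
Proof. by rewrite -big_split; apply: eq_bigr => i _; rewrite mxE mulrDl. Qed.

Lemma dotZl a u v : dot (a *: u) v = a * dot u v.
Proof. by rewrite mulr_sumr; apply: eq_bigr => i _; rewrite mxE mulrA. Qed.

Lemma dotNl u v : dot (- u) v = - dot u v.
Proof. by rewrite -scaleN1r dotZl mulN1r. Qed.

Lemma dotBl u v w : dot (u - v) w = dot u w - dot v w.
Proof. by rewrite dotDl dotNl. Qed.

Lemma dotDr u v w : dot w (u + v) = dot w u + dot w v.
Proof. by rewrite dotC dotDl !(dotC w). Qed.

Lemma dotZr a u v : dot u (a *: v) = a * dot u v.
Proof. by rewrite dotC dotZl dotC. Qed.

Lemma dotNr u v : dot u (- v) = - dot u v.
Proof. by rewrite dotC dotNl dotC. Qed.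

Lemma dotBr u v w : dot w (u - v) = dot w u - dot w v.
Proof. by rewrite dotDr dotNr. Qed.

Lemma dot0l u : dot 0 u = 0.
Proof. by rewrite -(scale0r 0) dotZl mul0r. Qed.

Lemma dot0r u : dot u 0 = 0.
Proof. by rewrite dotC dot0l. Qed.

Lemma dotxx_ge0 u : 0 <= dot u u.
Proof. by apply: sumr_ge0 => i _; rewrite -expr2 sqr_ge0. Qed.

Lemma enorm_dot u : enorm u = Num.sqrt (dot u u).
Proof. by rewrite /enorm big_ord1; congr Num.sqrt; apply: eq_bigr. Qed.

Lemma enorm_sqr u : enorm u ^+ 2 = dot u u.
Proof. by rewrite enorm_dot sqr_sqrtr// dotxx_ge0. Qed.

Lemma enorm_ge0 u : 0 <= enorm u.
Proof. exact: sqrtr_ge0. Qed.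

Lemma enorm0 : enorm (0 : 'rV[R]_n) = 0.
Proof. by rewrite enorm_dot dot0l sqrtr0. Qed.

Lemma enormZ a u : enorm (a *: u) = `|a| * enorm u.
Proof.
by rewrite !enorm_dot dotZl dotZr mulrA -expr2 sqrtrM ?sqr_ge0// sqrtr_sqr.
Qed.

Lemma enormN u : enorm (- u) = enorm u.
Proof. by rewrite -scaleN1r enormZ normrN1 mul1r. Qed.

Lemma enormC u v : enorm (u - v) = enorm (v - u).
Proof. by rewrite -enormN opprB. Qed.

Lemma dot_eq0 u : dot u u = 0 -> u = 0.
Proof.
move=> /eqP; rewrite psumr_eq0 => [/allP h|i _]; last by rewrite -expr2 sqr_ge0.
apply/rowP => i; rewrite mxE; have := h i (mem_index_enum _).
by rewrite /= mulf_eq0 orbb => /eqP.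
Qed.

Lemma enorm_eq0 u : enorm u = 0 -> u = 0.
Proof. by move=> e; apply: dot_eq0; rewrite -enorm_sqr e expr0n. Qed.

(** Cauchy-Schwarz: the squared norm of [enorm v *: u - enorm u *: v] is nonnegative and equals [2 *
    (enorm u * enorm v) * (enorm u * enorm v - dot u v)]. *)
Lemma dot_le u v : dot u v <= enorm u * enorm v.
Proof.
have [/eqP/enorm_eq0->|nu0] := boolP (enorm u == 0).
  by rewrite dot0l mulr_ge0// enorm_ge0.
have [/eqP/enorm_eq0->|nv0] := boolP (enorm v == 0).
  by rewrite dot0r mulr_ge0// enorm_ge0.
have u0 : 0 < enorm u by rewrite lt_def nu0 enorm_ge0.
have v0 : 0 < enorm v by rewrite lt_def nv0 enorm_ge0.
have := dotxx_ge0 (enorm v *: u - enorm u *: v).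
rewrite dotBl !dotBr !dotZl !dotZr -!enorm_sqr (dotC v u).
have -> : enorm v * (enorm v * enorm u ^+ 2) - enorm v * (enorm u * dot u v)
  - (enorm u * (enorm v * dot u v) - enorm u * (enorm u * enorm v ^+ 2)) =
  2 * (enorm u * enorm v) * (enorm u * enorm v - dot u v) by ring.
by rewrite pmulr_rge0 ?subr_ge0// mulr_gt0// mulr_gt0.
Qed.

Lemma normr_dot_le u v : `|dot u v| <= enorm u * enorm v.
Proof. by rewrite ler_norml dot_le andbT lerNl -dotNl -(enormN u) dot_le. Qed.

Lemma enormD u v : enorm (u + v) <= enorm u + enorm v.
Proof.
rewrite -(ler_pXn2r (n := 2)) ?nnegrE ?enorm_ge0 ?addr_ge0 ?enorm_ge0//.
rewrite enorm_sqr dotDl !dotDr -!enorm_sqr (dotC v u) sqrrD.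
have := dot_le u v; lra.
Qed.

Lemma enormB u v : enorm (u - v) <= enorm u + enorm v.
Proof. by rewrite -(enormN v) enormD. Qed.

Lemma enorm_triangle x y z : enorm (x - z) <= enorm (x - y) + enorm (y - z).
Proof. by rewrite (_ : x - z = (x - y) + (y - z)) ?enormD// addrA subrK. Qed.

Lemma normr_coord_le u i : `|u 0 i| <= enorm u.
Proof.
rewrite -(ler_pXn2r (n := 2)) ?nnegrE ?enorm_ge0// enorm_sqr -normrX ger0_norm ?sqr_ge0//.
rewrite /dot (bigD1 i)//= expr2 lerDl; apply: sumr_ge0 => j _.
by rewrite -expr2 sqr_ge0.
Qed.

Lemma enorm_le_sum u : enorm u <= \sum_i `|u 0 i|.
Proof.
have h0 : 0 <= \sum_i `|u 0 i| by apply: sumr_ge0.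
rewrite -(ler_pXn2r (n := 2)) ?nnegrE ?enorm_ge0// enorm_sqr expr2 mulr_suml.
apply: ler_sum => i _.
apply: (@le_trans _ _ (`|u 0 i| * `|u 0 i|)); first by rewrite -normrM ler_norm.
apply: ler_wpM2l => //; rewrite (bigD1 i)//= lerDl; exact: sumr_ge0.
Qed.

Lemma norm_le_enorm u : `|u| <= enorm u.
Proof.
rewrite [leLHS]/Num.norm /= mx_normrE; apply/bigmax_leP; split; first exact: enorm_ge0.
by move=> -[i j] _ /=; rewrite ord1 normr_coord_le.
Qed.

Lemma normr_coord_norm u i : `|u 0 i| <= `|u|.
Proof.
rewrite [leRHS]/Num.norm /= mx_normrE.
by apply/bigmax_geP; right; exists (0, i).
Qed.

Lemma enorm_le_norm u : enorm u <= n%:R * `|u|.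
Proof.
apply: (le_trans (enorm_le_sum u)).
have -> : n%:R * `|u| = \sum_(i < n) `|u| by rewrite sumr_const card_ord mulr_natl.
by apply: ler_sum => i _; exact: normr_coord_norm.
Qed.

(** The topology of rows is that of the sup norm; together with [eball_sub_ball] this shows that
    Euclidean balls give the same neighbourhoods. The [+ 1] in the radius covers [n = 0]. *)
Lemma ball_eball x (e : R) : 0 < e -> exists2 d, 0 < d & ball x d `<=` eball x e.
Proof.
move=> e0; exists (e / (n%:R + 1)).
  by rewrite divr_gt0// ltr_wpDl.
move=> y; rewrite -ball_normE /= /eball /= => xy.
apply: (le_lt_trans (enorm_le_norm _)).
apply: (@le_lt_trans _ _ ((n%:R + 1) * `|y - x|)).
  by rewrite ler_wpM2r// lerDl.
by rewrite mulrC -ltr_pdivlMr ?ltr_wpDl// distrC.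
Qed.

Lemma eball_sub_ball x (e : R) : eball x e `<=` ball x e.
Proof.
move=> y; rewrite -ball_normE /= /eball /= distrC => /(le_lt_trans _); apply.
exact: norm_le_enorm.
Qed.

Lemma nbhs_eball x (e : R) : 0 < e -> nbhs x (eball x e).
Proof. by move=> /(ball_eball x)[d d0 s]; apply/nbhs_ballP; exists d. Qed.

Lemma nbhs_eballP x (A : set 'rV[R]_n) :
  nbhs x A <-> exists2 e, 0 < e & eball x e `<=` A.
Proof.
split=> [/nbhs_ballP[e e0 s]|[e e0 s]].
  by exists e => //; apply: subset_trans s; exact: eball_sub_ball.
by apply: filterS (nbhs_eball x e0).
Qed.

Lemma open_eballP (A : set 'rV[R]_n) :
  open A <-> forall x, A x -> exists2 e, 0 < e & eball x e `<=` A.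
Proof.
rewrite openE; split => h x /h; first by move/nbhs_eballP.
by move=> s; apply/nbhs_eballP.
Qed.

Lemma open_eball (A : set 'rV[R]_n) x : open A -> A x ->
  exists2 e, 0 < e & eball x e `<=` A.
Proof. by move/open_eballP; exact. Qed.

Lemma eball_open x e : open (eball x e).
Proof.
apply/open_eballP => y; rewrite /eball /= => xy.
exists (e - enorm (y - x)); first by rewrite subr_gt0.
move=> z /= zy; apply: (le_lt_trans (enorm_triangle z y x)); lra.
Qed.

Lemma eball_le x d e : d <= e -> eball x d `<=` eball x e.
Proof. by move=> de y /lt_le_trans; apply. Qed.

Lemma eball_center x e : 0 < e -> eball x e x.
Proof. by rewrite /eball /= subrr enorm0. Qed.

End EuclideanNorm.

Lemma dot_row_mx (R : realType) m n (x u : 'rV[R]_m) (y v : 'rV[R]_n) :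
  dot (row_mx x y) (row_mx u v) = dot x u + dot y v.
Proof.
rewrite /dot big_split_ord; congr (_ + _); apply: eq_bigr => i _.
  by rewrite !row_mxEl.
by rewrite !row_mxEr.
Qed.

Lemma enorm_row_mx (R : realType) m n (x : 'rV[R]_m) (y : 'rV[R]_n) :
  enorm (row_mx x y) <= enorm x + enorm y.
Proof.
rewrite -(ler_pXn2r (n := 2)) ?nnegrE ?enorm_ge0 ?addr_ge0 ?enorm_ge0//.
rewrite enorm_sqr dot_row_mx -!enorm_sqr sqrrD.
have := mulr_ge0 (enorm_ge0 x) (enorm_ge0 y); lra.
Qed.

Lemma enorm_lsubmx (R : realType) m n (z : 'rV[R]_(m + n)) :
  enorm (lsubmx z) <= enorm z.
Proof.
rewrite -(ler_pXn2r (n := 2)) ?nnegrE ?enorm_ge0//.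
by rewrite !enorm_sqr -[in leRHS](hsubmxK z) dot_row_mx lerDl dotxx_ge0.
Qed.

Lemma eball_continuousP (R : realType) m n (f : 'rV[R]_m -> 'rV[R]_n) x :
  {for x, continuous f} <->
  forall e, 0 < e -> exists2 d, 0 < d & forall y, eball x d y -> enorm (f y - f x) < e.
Proof.
split=> [cf e e0|h A /nbhs_eballP[e e0 s]].
  have /cf : nbhs (f x) (eball (f x) e) by exact: nbhs_eball.
  by move=> /nbhs_eballP[d d0 s]; exists d => // y /s.
have [d d0 hd] := h e e0.
apply/nbhs_eballP; exists d => // y /hd ?; exact: s.
Qed.

Lemma eball_continuousRP (R : realType) m (f : 'rV[R]_m -> R) x :
  {for x, continuous f} <->
  forall e, 0 < e -> exists2 d, 0 < d & forall y, eball x d y -> `|f y - f x| < e.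
Proof.
split=> [cf e e0|h A /nbhs_ballP[e e0 s]].
  have /cf : nbhs (f x) (ball (f x) e) by apply/nbhs_ballP; exists e.
  move=> /nbhs_eballP[d d0 s]; exists d => // y /s.
  by rewrite /= -ball_normE /= distrC.
have [d d0 hd] := h e e0.
apply/nbhs_eballP; exists d => // y /hd hy; apply: s.
by rewrite /= -ball_normE /= distrC.
Qed.

HB.instance Definition _ (R : realType) (m n : nat) := Complete.on 'M[R]_(m, n).

(** * Genericity in definable families *)

Section Generic.
Variables (R : realType) (D : forall n, set (set 'rV[R]_n)).
Arguments D : clear implicits.
Hypothesis hD : o_minimal D.

(** The points off the topological boundary of [Z]. Thus [undecided_nowhere_dense] says that
    boundaries of definable sets are nowhere dense. *)
Definition decided n (Z : set 'rV[R]_n) (x : 'rV[R]_n) :=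
  (exists2 e, 0 < e & eball x e `<=` Z) \/
  (exists2 e, 0 < e & eball x e `<=` ~` Z).

Definition undecided_nowhere_dense n := forall (X U : set 'rV[R]_n),
  D n X -> open U -> U !=set0 -> exists2 x, U x & decided X x.

Lemma open_decided n (Z : set 'rV[R]_n) : open [set x | decided Z x].
Proof.
have -> : [set x | decided Z x] = Z° `|` (~` Z)°.
  by apply/seteqP; split => x; rewrite /decided /interior /= => -[?|?]; [left|right|left|right];
    apply/nbhs_eballP.
by apply: openU; exact: open_interior.
Qed.

(* Baire: countably many dense open sets of decided points meet. *)
Lemma generic_from_decided n (T : countType) (Z : T -> set 'rV[R]_n) (U : set 'rV[R]_n) :
  undecided_nowhere_dense n ->
  (forall i, D n (Z i)) -> open U -> U !=set0 ->
  exists2 x, U x & forall i, decided (Z i) x.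
Proof.
move=> hn dZ oU U0.
(* Integers that code no index get the whole space, which is open and dense. *)
pose F k := if unpickle k is Some i then [set x | decided (Z i) x] else setT.
have := @Baire R 'rV[R]_n F _ U U0 oU; case.
  move=> k; rewrite /F; case: unpickle => [i|]; last first.
    by split; [exact: openT|move=> O O0 oO; rewrite setIT].
  split; first exact: open_decided.
  by move=> O O0 oO; have [x Ox dx] := hn _ _ (dZ i) oO O0; exists x.
move=> x [Ux Fx]; exists x => // i.
by have := Fx (pickle i) I; rewrite /F pickleK.
Qed.


(** * Definable subsets of the line just to the right of a point *)

Definition eventually_right (a : R) (P : R -> Prop) :=
  exists2 e, 0 < e & forall t, a < t -> t < a + e -> P t.

(** The form in which the axiom on [D 1] is used. Unlike an explicit union of points and intervals,
    it passes to complements and unions at once. *)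
Definition right_decided (P : R -> Prop) := forall a,
  eventually_right a P \/ eventually_right a (fun t => ~ P t).

Lemma eventually_right_and a P Q :
  eventually_right a P -> eventually_right a Q ->
  eventually_right a (fun t => P t /\ Q t).
Proof.
move=> [e e0 he] [d d0 hd]; exists (Num.min e d); first by rewrite lt_min e0.
by move=> t ta; rewrite -ltrBlDl lt_min => /andP[? ?]; split; [apply: he|apply: hd];
  rewrite // -ltrBlDl.
Qed.

Lemma eventually_right_imp a (P Q : R -> Prop) :
  (forall t, P t -> Q t) -> eventually_right a P -> eventually_right a Q.
Proof. by move=> PQ [e e0 he]; exists e => // t ? ?; apply/PQ/he. Qed.

Lemma eventually_right_true a (P : R -> Prop) : (forall t, a < t -> P t) -> eventually_right a P.
Proof. by move=> h; exists 1 => // t ? _; apply: h. Qed.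

Lemma right_decided_or P Q :
  right_decided P -> right_decided Q -> right_decided (fun t => P t \/ Q t).
Proof.
move=> hP hQ a; have [p|np] := hP a.
  by left; apply: eventually_right_imp p => t; left.
have [q|nq] := hQ a.
  by left; apply: eventually_right_imp q => t; right.
right; apply: eventually_right_imp (eventually_right_and np nq) => t [? ?]; tauto.
Qed.

Lemma right_decided_not P : right_decided P -> right_decided (fun t => ~ P t).
Proof.
move=> hP a; have [p|np] := hP a; [right|by left].
by apply: eventually_right_imp p => t pt; apply.
Qed.

Lemma right_decided_iff P Q : (forall t, P t <-> Q t) -> right_decided P -> right_decided Q.
Proof.
move=> PQ hP a; have [h|h] := hP a; [left|right]; apply: eventually_right_imp h => t.
  by move/PQ.
by move=> nP /PQ.
Qed.

Lemma right_decided_cst (P : Prop) : right_decided (fun=> P).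
Proof. by move=> a; have [p|p] := pselect P; [left|right]; exact: eventually_right_true. Qed.

Lemma right_decided_ge x : right_decided (fun t => x <= t).
Proof.
move=> a; have [xa|ax] := leP x a.
  by left; apply: eventually_right_true => t /ltW; exact: le_trans.
by right; exists (x - a) => [|t _]; rewrite ?subr_gt0// addrC subrK ltNge => /negP.
Qed.

Lemma right_decided_gt x : right_decided (fun t => x < t).
Proof.
move=> a; have [xa|ax] := leP x a.
  by left; apply: eventually_right_true => t; exact: le_lt_trans.
right; exists (x - a) => [|t _]; rewrite ?subr_gt0// addrC subrK => tx.
by apply/negP; rewrite -leNgt ltW.
Qed.

Lemma right_decided_itv (J : interval R) : right_decided (fun t => t \in J).
Proof.
case: J => l r.
have hl : right_decided (fun t => (l <= BLeft t)%O).
  case: l => [[] x|[]].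
  - apply: right_decided_iff (@right_decided_ge x) => t; by rewrite bnd_simp.
  - apply: right_decided_iff (@right_decided_gt x) => t; by rewrite bnd_simp.
  - by apply: right_decided_iff (@right_decided_cst True) => t; rewrite bnd_simp.
  - by apply: right_decided_iff (@right_decided_cst False) => t; rewrite bnd_simp.
have hr : right_decided (fun t => (BRight t <= r)%O).
  case: r => [[] x|[]].
  - apply: right_decided_iff (right_decided_not (@right_decided_ge x)) => t.
    by rewrite bnd_simp ltNge; split => /negP.
  - apply: right_decided_iff (right_decided_not (@right_decided_gt x)) => t.
    by rewrite bnd_simp leNgt; split => /negP.
  - by apply: right_decided_iff (@right_decided_cst False) => t; rewrite bnd_simp.
  - by apply: right_decided_iff (@right_decided_cst True) => t; rewrite bnd_simp.
apply: right_decided_iff (right_decided_not (right_decided_or (right_decided_not hl)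
  (right_decided_not hr))) => t.
rewrite itv_boundlr; split => [h|/andP[-> ->] [|] //].
apply/andP; split; apply: contrapT => h'; apply: h; tauto.
Qed.

Lemma definable_right_decided (X : set 'rV[R]_1) :
  D 1 X -> right_decided (fun t => X (\row__ t)).
Proof.
move=> /(omin_dim1 hD)[P [I ->]].
apply: (right_decided_or (P := fun t => (\row__ t : 'rV[R]_1) 0 0 \in P)).
  elim: P => [|x P IH].
    by apply: right_decided_iff (@right_decided_cst False) => t.
  have := right_decided_or (@right_decided_itv `[x, x]) IH.
  apply: right_decided_iff => t; rewrite in_cons !mxE in_itv/= -eq_le.
  by rewrite eq_sym; split => [[->//|->]|/orP[]]; rewrite ?orbT; auto.
elim: I => [|J I IH].
  by apply: right_decided_iff (@right_decided_cst False) => t; split => // -[].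
have := right_decided_or (@right_decided_itv J) IH.
apply: right_decided_iff => t; rewrite !mxE; split.
  move=> [tJ|[K KI tK]]; first by exists J => //; rewrite inE eqxx.
  by exists K => //; rewrite inE KI orbT.
by move=> [K]; rewrite inE => /orP[/eqP->|KI] tK; [left|right; exists K].
Qed.

(** For rational [p < q], the base points over which the whole segment between heights [p] and [q]
    lies in [X], or the whole segment misses [X], form definable sets [Z] of dimension [n]. Near the
    projection of [z0] some [x] decides all of them. The fibre of [X] over [x] is constant just
    above the height [a] of [z0], so a short rational segment there puts [x] in some [Z (p, q, b)],
    hence a ball around [x] as well. The box over this ball between [p] and [q] is then inside [X]
    or disjoint from it. *)
Lemma decided_step n : undecided_nowhere_dense n -> undecided_nowhere_dense (n + 1).
Proof.
move=> hn X U dX /open_eballP oU [z0 /oU[e e0 hU]].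
set x0 := lsubmx z0; set a := rsubmx z0 0 0.
have e20 : 0 < e / 2 by rewrite divr_gt0.
have inU x t : eball x0 (e / 2) x -> a <= t < a + e / 2 -> U (row_mx x (\row__ t)).
  rewrite /eball /= => xx /andP[at1 at2]; apply: hU; rewrite /eball /=.
  have -> : row_mx x (\row__ t) - z0 = row_mx (x - x0) (\row__ (t - a)).
    rewrite -[z0 in LHS]hsubmxK opp_row_mx add_row_mx; congr row_mx.
    by apply/rowP => i; rewrite !mxE /a !ord1 mxE.
  apply: (le_lt_trans (enorm_row_mx _ _)).
  have := enorm_le_sum (\row__ (t - a) : 'rV[R]_1).
  rewrite big_ord1 mxE ger0_norm ?subr_ge0//; lra.
pose Z (i : rat * rat * bool) := [set x : 'rV[R]_n | forall t : R,
  ratr i.1.1 < t -> t < ratr i.1.2 -> if i.2 then X (row_mx x (\row__ t))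
    else ~ X (row_mx x (\row__ t))].
have dZ i : D n (Z i).
  have dX' : D (n + 1)%N [set z | X (row_mx (lsubmx z) (\row__ rsubmx z 0 0))].
    have -> // : [set z | X (row_mx (lsubmx z) (\row__ rsubmx z 0 0))] = X.
    apply/seteqP; split => z /=; rewrite (_ : row_mx _ _ = z)//;
      rewrite -[z in RHS]hsubmxK; congr row_mx; apply/rowP => j; by rewrite mxE ord1.
  by rewrite /Z; case: i => -[p q] []; definability hD.
have [x xU hx] := generic_from_decided hn dZ (@eball_open R n x0 (e / 2))
  (ex_intro _ x0 (@eball_center R n x0 _ e20)).
have dfib : D 1 [set t | X (row_mx x t)].
  apply: (definable_preim hD (h := fun t : 'rV[R]_1 => row_mx x t)) => //.
  by definability hD.
have [b [d d0 hd]] : exists b : bool, eventually_right a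
    (fun t => if b then X (row_mx x (\row__ t)) else ~ X (row_mx x (\row__ t))).
  by have [h|h] := definable_right_decided dfib a; [exists true|exists false].
set m := Num.min d (e / 2).
have m0 : 0 < m by rewrite lt_min d0.
have md : m <= d by rewrite ge_min lexx.
have me : m <= e / 2 by rewrite ge_min lexx orbT.
have [p] : exists q, ratr q \in `]a, (a + m)[ by apply: rat_in_itvoo; rewrite ltrDl.
rewrite in_itv /= => /andP[ap pm].
have [q] : exists q, ratr q \in `](ratr p), (a + m)[ by apply: rat_in_itvoo.
rewrite in_itv /= => /andP[pq qm].
have xZ : Z (p, q, b) x.
  by move=> t /= pt tq; apply: hd; lra.
have [k k0 hk] : exists2 k, 0 < k & eball x k `<=` Z (p, q, b).
  by have [//|[k k0 /(_ x (@eball_center R n x _ k0))]] := hx (p, q, b).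
set c : R := (ratr p + ratr q) / 2.
exists (row_mx x (\row__ c)); first by apply: inU => //; apply/andP; rewrite /c; lra.
(* The point has height [c] midway between [p] and [q], so a ball of this radius stays in the
   box. *)
set s := Num.min k ((ratr q - ratr p) / 2).
have s0 : 0 < s by rewrite lt_min k0 divr_gt0// subr_gt0.
have key w : eball (row_mx x (\row__ c)) s w -> if b then X w else ~ X w.
  rewrite /eball /= lt_min => /andP[h1 h2].
  have wE : w = row_mx (lsubmx w) (\row__ rsubmx w 0 0).
    rewrite -[LHS]hsubmxK; congr row_mx; apply/rowP => j; by rewrite mxE ord1.
  have hc : `|rsubmx w 0 0 - c| <= enorm (w - row_mx x (\row__ c)).
    have -> : rsubmx w 0 0 - c = (w - row_mx x (\row__ c)) 0 (rshift n 0).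
      by rewrite 3!mxE row_mxEr !mxE.
    exact: normr_coord_le.
  rewrite wE; apply: (hk (lsubmx w)) => /=.
  - rewrite /eball /=; apply: le_lt_trans h1.
    apply: le_trans (enorm_lsubmx _); rewrite linearB /= row_mxKl//.
  - by move: h2 hc; rewrite ler_norml /c => h2 /andP[]; lra.
  - by move: h2 hc; rewrite ler_norml /c => h2 /andP[]; lra.
by case: b key {hd xZ hk} => key; [left|right]; exists s.
Qed.

Lemma definable_decided n : undecided_nowhere_dense n.
Proof.
elim: n => [|n IH]; last by rewrite -addn1; exact: decided_step.
move=> X U _ _ [x Ux]; exists x => //.
have e0 (y : 'rV[R]_0) : y = x by apply/rowP => -[].
by have [Xx|Xx] := pselect (X x); [left|right]; exists 1 => // y _ /=; rewrite (e0 y).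
Qed.

Lemma generic_point n (T : countType) (Z : T -> set 'rV[R]_n) (U : set 'rV[R]_n) :
  (forall i, D n (Z i)) -> open U -> U !=set0 ->
  exists2 x, U x & forall i, decided (Z i) x.
Proof. exact: generic_from_decided (@definable_decided n). Qed.

End Generic.

(** * Differentiability of definable functions at generic points *)

Section Calculus.
Variables (R : realType).

(** Let [m] be the supremum of the [s] with [k a <= k s]. Continuity gives [k a <= k m], and if
    [m < b] the hypothesis to the right of [m] produces a larger such [s]. *)
Lemma right_nondecreasing_le (k : R -> R) (a b : R) : a <= b ->
  (forall s, a <= s <= b -> forall e, 0 < e -> exists2 d, 0 < d &
    forall t, a <= t <= b -> `|t - s| < d -> `|k t - k s| < e) ->
  (forall s, a <= s < b -> eventually_right s (fun t => k s <= k t)) ->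
  k a <= k b.
Proof.
move=> ab kc kr.
pose S := [set s | a <= s <= b /\ k a <= k s].
have Sa : S a by split => //; rewrite lexx.
have hS : has_sup S by split; [exists a|exists b => s [/andP[]]].
set m := sup S.
have am : a <= m by apply: sup_upper_bound.
have mb : m <= b by apply: ge_sup; [exists a|move=> s [/andP[]]].
have mab : a <= m <= b by rewrite am mb.
have km : k a <= k m.
  rewrite leNgt; apply/negP => lt.
  have [||d d0 hd] := kc m _ (k a - k m); rewrite ?subr_gt0//.
  have [s Ss ms] := sup_adherent d0 hS.
  have sm : s <= m by apply: sup_upper_bound.
  have [sab kas] := Ss.
  have := hd s sab; rewrite ler0_norm ?subr_le0// => /(_ ltac:(rewrite -/m in ms *; lra)).
  rewrite ltr_norml => /andP[]; lra.
have [->//|] := eqVneq b m; rewrite eq_sym => nbm.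
have ltmb : m < b by rewrite lt_def eq_sym nbm.
have [|e e0 he] := kr m; first by rewrite am.
pose t := Num.min b (m + e / 2).
have mt : m < t by rewrite lt_min ltmb ltrDl divr_gt0.
have te : t < m + e by rewrite gt_min; apply/orP; right; lra.
have tb : t <= b by rewrite ge_min lexx.
have : t <= m.
  apply: sup_upper_bound => //; split; first by rewrite tb (le_trans am (ltW mt)).
  exact: le_trans km (he t mt te).
by rewrite leNgt mt.
Qed.

Variable n : nat.
Implicit Types (h : 'rV[R]_n -> R) (x v : 'rV[R]_n).

(** Here and in [has_dder] the condition is a first-order formula in [h], in a shape accepted by
    [definability]; difference quotients are multiplied out, which also makes [t = 0] harmless. *)
Definition cont_at h x := forall e, 0 < e -> exists d, 0 < d /\
  forall y : 'rV[R]_n, enorm (y - x) < d -> `|h y - h x| < e.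

Definition has_dder h v x (c : R) := forall e, 0 < e -> exists d, 0 < d /\
  forall t, `|t| < d -> `|h (x + t *: v) - h x - c * t| <= e * `|t|.

Lemma cont_at_line h x v (a b p : R) :
  (forall t, a <= t <= b -> cont_at h (x + t *: v)) ->
  forall s, a <= s <= b -> forall e, 0 < e -> exists2 d, 0 < d &
    forall t, a <= t <= b -> `|t - s| < d ->
      `|(h (x + t *: v) - p * t) - (h (x + s *: v) - p * s)| < e.
Proof.
move=> hc s sab e e0; have e20 : 0 < e / 2 by rewrite divr_gt0.
have [d [d0 hd]] := hc s sab _ e20.
have v1 : 0 < enorm v + 1 by rewrite ltr_wpDl ?enorm_ge0.
have p1 : 0 < `|p| + 1 by rewrite ltr_wpDl.
exists (Num.min (d / (enorm v + 1)) (e / 2 / (`|p| + 1))).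
  by rewrite lt_min !divr_gt0.
move=> t _; rewrite lt_min !ltr_pdivlMr// => /andP[h1 h2].
have {h2} h2 : `|p * (t - s)| < e / 2.
  by rewrite normrM; have := normr_ge0 (t - s); lra.
have := hd (x + t *: v); rewrite opprD addrACA subrr add0r -scalerBl enormZ.
have h3 : `|t - s| * enorm v < d.
  by apply: le_lt_trans h1; rewrite ler_wpM2l// lerDl.
move=> /(_ h3) h4.
have -> : h (x + t *: v) - p * t - (h (x + s *: v) - p * s) =
  (h (x + t *: v) - h (x + s *: v)) - p * (t - s) by ring.
apply: (le_lt_trans (ler_normB _ _)); lra.
Qed.

(** A mean value inequality that asks only for right slopes: [right_nondecreasing_le] applied to
    [h (x + t *: v) - p * t]. *)
Lemma slope_ge h x v (a b p : R) : a <= b ->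
  (forall t, a <= t <= b -> cont_at h (x + t *: v)) ->
  (forall s, a <= s < b -> eventually_right s (fun t =>
     p * (t - s) <= h (x + t *: v) - h (x + s *: v))) ->
  p * (b - a) <= h (x + b *: v) - h (x + a *: v).
Proof.
move=> ab hc hr.
have := right_nondecreasing_le (k := fun t => h (x + t *: v) - p * t) ab
  (cont_at_line p hc).
have H s : a <= s < b -> eventually_right s (fun t =>
    h (x + s *: v) - p * s <= h (x + t *: v) - p * t).
  by move=> /hr; apply: eventually_right_imp => t; lra.
by move=> /(_ H); lra.
Qed.

Lemma cont_atN h x : cont_at h x -> cont_at (fun y => - h y) x.
Proof.
move=> hc e /hc[d [d0 hd]]; exists d; split => // y /hd.
by rewrite -opprD normrN.
Qed.

Lemma slope_le h x v (a b p : R) : a <= b ->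
  (forall t, a <= t <= b -> cont_at h (x + t *: v)) ->
  (forall s, a <= s < b -> eventually_right s (fun t =>
     h (x + t *: v) - h (x + s *: v) <= p * (t - s))) ->
  h (x + b *: v) - h (x + a *: v) <= p * (b - a).
Proof.
move=> ab hc hr.
have := @slope_ge (fun y => - h y) x v a b (- p) ab.
move=> /(_ (fun t tab => cont_atN (hc t tab))) H.
suff : - p * (b - a) <= - h (x + b *: v) - - h (x + a *: v) by lra.
by apply: H => s /hr; apply: eventually_right_imp => t; lra.
Qed.

Lemma has_dder_unique h v x c c' : has_dder h v x c -> has_dder h v x c' -> c = c'.
Proof.
move=> hc hc'; apply/eqP; rewrite -subr_eq0 -normr_le0; apply/ler_addgt0Pr => e e0.
have e20 : 0 < e / 2 by rewrite divr_gt0.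
have [d [d0 hd]] := hc _ e20; have [d' [d0' hd']] := hc' _ e20.
pose t := Num.min d d' / 2.
have m0 : 0 < Num.min d d' by rewrite lt_min d0.
have t0 : 0 < t by rewrite divr_gt0.
have td : t < Num.min d d' by rewrite /t; lra.
move: td; rewrite lt_min => /andP[td td'].
have := hd t; have := hd' t; rewrite gtr0_norm// => /(_ td') h1 /(_ td) h2.
rewrite add0r -(ler_pM2r t0) -{1}(gtr0_norm t0) -normrM.
have -> : (c - c') * t = (h (x + t *: v) - h x - c' * t) - (h (x + t *: v) - h x - c * t).
  by ring.
apply: (le_trans (ler_normB _ _)); lra.
Qed.

Lemma has_dderZ h v x c a : has_dder h v x c -> has_dder h (a *: v) x (a * c).
Proof.
move=> hc e e0; have a1 : 0 < `|a| + 1 by rewrite ltr_wpDl.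
have [d [d0 hd]] := hc _ (divr_gt0 e0 a1).
exists (d / (`|a| + 1)); split; first exact: divr_gt0.
move=> t; rewrite ltr_pdivlMr// => ht.
have h1 : `|t * a| < d.
  by rewrite normrM; apply: le_lt_trans ht; rewrite ler_wpM2l// lerDl.
have := hd _ h1; rewrite scalerA.
have -> : c * (t * a) = a * c * t by ring.
move=> /le_trans; apply.
have -> : e / (`|a| + 1) * `|t * a| = e * `|t| * (`|a| / (`|a| + 1)).
  by rewrite normrM; ring.
rewrite ler_piMr//; first by rewrite mulr_ge0// ltW.
by rewrite ler_pdivrMr// mul1r lerDl.
Qed.

Lemma near_segment x v (r : R) : 0 < r ->
  exists2 d, 0 < d & forall t, `|t| < d -> eball x r (x + t *: v).
Proof.
move=> r0; have v1 : 0 < enorm v + 1 by rewrite ltr_wpDl ?enorm_ge0.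
exists (r / (enorm v + 1)); first exact: divr_gt0.
move=> t; rewrite ltr_pdivlMr// /eball /= [x + _]addrC addrK enormZ; apply: le_lt_trans.
by rewrite ler_wpM2l// lerDl.
Qed.

Lemma has_dder_eq h k v x c r : 0 < r -> (forall y, eball x r y -> h y = k y) ->
  has_dder h v x c -> has_dder k v x c.
Proof.
move=> r0 hk hc e /hc[d [d0 hd]]; have [d' d0' hd'] := near_segment x v r0.
exists (Num.min d d'); split; first by rewrite lt_min d0.
move=> t; rewrite lt_min => /andP[td td'].
by rewrite -(hk _ (hd' _ td')) -(hk x (eball_center _ r0)) hd.
Qed.

Lemma cont_at_eq h k x r : 0 < r -> (forall y, eball x r y -> h y = k y) ->
  cont_at h x -> cont_at k x.
Proof.
move=> r0 hk hc e /hc[d [d0 hd]].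
exists (Num.min d r); split; first by rewrite lt_min d0.
move=> y; rewrite lt_min => /andP[yd yr].
by rewrite -(hk _ yr) -(hk x (eball_center _ r0)) hd.
Qed.

Lemma line_shift x v (s t : R) : x + s *: v + (t - s) *: v = x + t *: v.
Proof. by rewrite -addrA -scalerDl [s + _]addrC subrK. Qed.

Lemma dder_slope_ge h x v (p : R) :
  (forall t, 0 <= t <= 1 -> cont_at h (x + t *: v)) ->
  (forall t, 0 <= t <= 1 -> exists2 c, has_dder h v (x + t *: v) c & p <= c) ->
  p <= h (x + v) - h x.
Proof.
move=> hc hd; apply/ler_addgt0Pr => e e0.
have := @slope_ge h x v 0 1 (p - e) ler01 hc.
rewrite subr0 mulr1 scale1r scale0r addr0 => H; rewrite -lerBlDr; apply: H.
move=> s /andP[s0 s1].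
have [|c hcd pc] := hd s; first by rewrite s0 ltW.
have [d [d0 hd']] := hcd e e0.
exists d => // t st td; have := hd' (t - s).
rewrite line_shift gtr0_norm ?subr_gt0//.
move=> /(_ ltac:(lra)); rewrite ler_norml => /andP[h1 _].
have : p * (t - s) <= c * (t - s) by rewrite ler_wpM2r// subr_ge0 ltW.
lra.
Qed.

Lemma dder_slope_approx h x v (p e : R) :
  (forall t, 0 <= t <= 1 -> cont_at h (x + t *: v)) ->
  (forall t, 0 <= t <= 1 -> exists2 c, has_dder h v (x + t *: v) c & `|c - p| <= e) ->
  `|h (x + v) - h x - p| <= e.
Proof.
move=> hc hd.
have h1 : p - e <= h (x + v) - h x.
  apply: dder_slope_ge => // t /hd[c h1 h2]; exists c => //.
  by move: h2; rewrite ler_norml => /andP[]; lra.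
have h2 : - (p + e) <= (- h (x + v)) - (- h x).
  apply: (@dder_slope_ge (fun y => - h y)) => t t01; first exact/cont_atN/hc.
  have [c h2 h3] := hd t t01; exists (- c).
    move=> a /h2[d [d0 h4]]; exists d; split => // s /h4.
    by rewrite mulNr -!opprD normrN.
  by move: h3; rewrite ler_norml => /andP[]; lra.
rewrite ler_norml; apply/andP; lra.
Qed.

End Calculus.

Section GenericDifferentiability.
Variables (R : realType) (D : forall n, set (set 'rV[R]_n)).
Arguments D : clear implicits.
Hypothesis hD : o_minimal D.
Variable n : nat.
Implicit Types (h : 'rV[R]_n -> R) (x v : 'rV[R]_n) (V X : set 'rV[R]_n).

(** Turns the existence of one good point in every open set into an open set of good points: near a
    decided point, density rules out that [X] is avoided. *)
Lemma dense_definable_open X V : D n X -> open V -> V !=set0 ->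
  (forall W, open W -> W !=set0 -> W `<=` V -> exists2 x, W x & X x) ->
  exists V', [/\ open V', V' !=set0, V' `<=` V & V' `<=` X].
Proof.
move=> dX oV V0 hd; have [x Vx] := definable_decided hD dX oV V0.
have oI e : open (eball x e `&` V) by apply: openI => //; exact: eball_open.
move=> [[e e0 he]|[e e0 he]].
  exists (eball x e `&` V); split => //.
  - by exists x; split => //; exact: eball_center.
  - by move=> y [/he].
have [|y [/he]//] := hd _ (oI e) _ (@subIsetr _ _ _).
by exists x; split => //; exact: eball_center.
Qed.

Lemma definable_cont_at h : definable_fun D h -> D n [set x | cont_at h x].
Proof. by move=> dh; rewrite /cont_at; definability hD. Qed.

(** At a point deciding all sets [h < q] and [q < h] with [q] rational, [h] is continuous: rationals
    just below and just above [h x] bound [h] on a whole ball. Such points are dense, and continuity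
    is a definable condition. *)
Lemma definable_continuous_open h V : definable_fun D h -> open V -> V !=set0 ->
  exists V', [/\ open V', V' !=set0, V' `<=` V & forall x, V' x -> cont_at h x].
Proof.
move=> dh oV V0; apply: dense_definable_open => //; first exact: definable_cont_at.
move=> W oW W0 _.
pose Z (i : rat * bool) := [set x | if i.2 then h x < ratr i.1 else ratr i.1 < h x].
have dZ i : D n (Z i) by rewrite /Z; case: i => q [] /=; definability hD.
have [x Wx hx] := generic_point hD dZ oW W0.
exists x => // e e0.
have near i : Z i x -> exists2 d, 0 < d & eball x d `<=` Z i.
  by move=> Zx; have [//|[d d0 /(_ x (eball_center _ d0))]] := hx i.
have [q] : exists q, ratr q \in `](h x), (h x + e)[ by apply: rat_in_itvoo; rewrite ltrDl.
have [p] : exists q, ratr q \in `](h x - e), (h x)[ by apply: rat_in_itvoo; lra.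
rewrite !in_itv /= => /andP[p1 p2] /andP[q1 q2].
have [d d0 hd] := near (q, true) q1; have [d' d0' hd'] := near (p, false) p2.
exists (Num.min d d'); split; first by rewrite lt_min d0.
move=> y; rewrite lt_min => /andP[yd yd'].
have := hd y yd; have := hd' y yd'; rewrite /Z /= => h1 h2.
rewrite ltr_norml; apply/andP; lra.
Qed.

Definition right_slope_ge h v (p : R) x := exists e, 0 < e /\
  forall t, 0 < t -> t < e -> p * t <= h (x + t *: v) - h x.

(** The set of [t] with [p * t <= h (x + t *: v) - h x] is definable in the line, so it contains all
    small [t > 0] or none. *)
Lemma right_slope_dichotomy h v p x : definable_fun D h -> ~ right_slope_ge h v p x ->
  eventually_right 0 (fun t => h (x + t *: v) - h x < p * t).
Proof.
move=> dh np.
have dX : D 1 [set t : 'rV[R]_1 | p * t 0 0 <= h (x + t 0 0 *: v) - h x].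
  by definability hD.
have [[e e0 he]|] := definable_right_decided hD dX 0.
  exfalso; apply: np; exists e; split => // t t0 te.
  by have := he t t0; rewrite add0r /= mxE; apply.
by apply: eventually_right_imp => t; rewrite /= mxE => /negP; rewrite -ltNge.
Qed.

(** The derivative at [x] is the supremum [L] of the [p] that the right slope at [x] reaches. If [x]
    decides the sets [RS q] for rational [q], then for [p < L < q] the right slopes on a ball are at
    least [p] and not at least [q]; by the mean value inequalities all difference quotients near [x]
    along [v], on both sides, lie between [p] and [q]. The two sets indexed by booleans are the
    points of right slope [+oo] and [-oo]; deciding them too makes [L] finite. *)
Lemma dder_exists_generic h v V : definable_fun D h ->
  open V -> V !=set0 -> (forall x, V x -> cont_at h x) ->
  exists2 x, V x & exists c, has_dder h v x c.
Proof.
move=> dh oV V0 hc.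
pose RS := right_slope_ge h v.
pose Z (i : rat + bool) : set 'rV[R]_n := match i with
  | inl q => [set x | RS (ratr q) x]
  | inr true => [set x | forall p, RS p x]
  | inr false => [set x | forall p, ~ RS p x] end.
have dZ i : D n (Z i) by rewrite /Z /RS /right_slope_ge; case: i => [q|[]]; definability hD.
have [x Vx hx] := generic_point hD dZ oV V0.
exists x => //.
have /open_eballP /(_ x Vx)[r r0 hr] := oV.
(* On a ball where the right slope is everywhere on one side of [p], so is
   every difference quotient along the line through [x]. *)
have up (W : set 'rV[R]_n) e : 0 < e -> eball x e `<=` W ->
    exists2 d, 0 < d & forall p, (forall y, W y -> RS p y) -> forall s t, `|s| < d -> `|t| < d -> s <= t ->
      p * (t - s) <= h (x + t *: v) - h (x + s *: v).
  move=> e0 hW.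
  have m0 : 0 < Num.min r e by rewrite lt_min r0.
  have [d d0 hd] := near_segment x v m0.
  exists d => // p hRS s t sd td st; apply: slope_ge => // u /andP[su ut].
    apply/hc/hr; apply: (@eball_le _ _ x (Num.min r e)); first by rewrite ge_min lexx.
    apply: hd; move: sd td; rewrite !ltr_norml => /andP[? ?] /andP[? ?].
    by apply/andP; lra.
  have [|k [k0 hk]] := hRS (x + u *: v).
    apply: hW; apply: (@eball_le _ _ x (Num.min r e)); first by rewrite ge_min lexx orbT.
    apply: hd; move: sd td; rewrite !ltr_norml => /andP[? ?] /andP[? ?].
    by apply/andP; lra.
  exists k => // w uw wk; have := hk (w - u).
  by rewrite line_shift subr_gt0; apply => //; lra.
have dn (W : set 'rV[R]_n) e : 0 < e -> eball x e `<=` W ->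
    exists2 d, 0 < d & forall p, (forall y, W y -> ~ RS p y) -> forall s t, `|s| < d -> `|t| < d -> s <= t ->
      h (x + t *: v) - h (x + s *: v) <= p * (t - s).
  move=> e0 hW.
  have m0 : 0 < Num.min r e by rewrite lt_min r0.
  have [d d0 hd] := near_segment x v m0.
  exists d => // p hRS s t sd td st; apply: slope_le => // u /andP[su ut].
    apply/hc/hr; apply: (@eball_le _ _ x (Num.min r e)); first by rewrite ge_min lexx.
    apply: hd; move: sd td; rewrite !ltr_norml => /andP[? ?] /andP[? ?].
    by apply/andP; lra.
  have [|k k0 hk] := @right_slope_dichotomy h v p (x + u *: v) dh.
    apply: hRS; apply: hW; apply: (@eball_le _ _ x (Num.min r e)).
      by rewrite ge_min lexx orbT.
    apply: hd; move: sd td; rewrite !ltr_norml => /andP[? ?] /andP[? ?].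
    by apply/andP; lra.
  exists k => // w uw wk; have := hk (w - u).
  rewrite line_shift subr_gt0 => H; apply/ltW/H => //; lra.
have d0 (a : R) : 0 < a -> `|0 : R| < a by rewrite normr0.
(* An infinite right slope at [x] would be infinite on a ball. Since [up] provides [d] before [p],
   one step [t] serves every [p], and the difference quotient at [t] would exceed itself plus
   one. *)
have nup : ~ forall p, RS p x.
  move=> H; have [|[e e0 he]] := hx (inr true); last first.
    exact: (he x (eball_center _ e0)).
  move=> [e e0 he]; have [d dd hd] := up _ e e0 he.
  pose t := d / 2; have t0 : 0 < t by rewrite divr_gt0.
  have td : `|t| < d by rewrite gtr0_norm// /t; lra.
  pose p := (h (x + t *: v) - h x) / t + 1.
  have := hd p (fun y Zy => Zy p) 0 t (d0 _ dd) td (ltW t0).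
  rewrite scale0r addr0 subr0 /p mulrDl divfK ?gt_eqF//; lra.
have ndn : ~ forall p, ~ RS p x.
  move=> H; have [|[e e0 he]] := hx (inr false); last first.
    exact: (he x (eball_center _ e0)).
  move=> [e e0 he]; have [d dd hd] := dn _ e e0 he.
  pose t := d / 2; have t0 : 0 < t by rewrite divr_gt0.
  have td : `|t| < d by rewrite gtr0_norm// /t; lra.
  pose p := (h (x + t *: v) - h x) / t - 1.
  have := hd p (fun y Zy => Zy p) 0 t (d0 _ dd) td (ltW t0).
  rewrite scale0r addr0 subr0 /p mulrBl divfK ?gt_eqF//; lra.
have RSle p q : p <= q -> RS q x -> RS p x.
  move=> pq [e [e0 he]]; exists e; split => // t t0 te; apply: le_trans (he t t0 te).
  by rewrite ler_wpM2r// ltW.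
pose S := [set p | RS p x].
have hS : has_sup S.
  split.
    by apply: contrapT => /forallNP hn; apply: ndn => p; apply: hn.
  have [p np] : exists p, ~ RS p x by apply/existsNP.
  exists p => q qS; rewrite leNgt; apply/negP => pq; apply: np.
  by apply: RSle qS; exact: ltW.
pose L := sup S.
exists L => e e0.
have [p] : exists q, ratr q \in `](L - e), L[ by apply: rat_in_itvoo; lra.
have [q] : exists q, ratr q \in `]L, (L + e)[ by apply: rat_in_itvoo; lra.
rewrite !in_itv /= => /andP[q1 q2] /andP[p1 p2].
have RSp : RS (ratr p) x.
  have [|s Ss ps] := @sup_adherent _ S (L - ratr p) _ hS; first by rewrite subr_gt0.
  by apply: RSle Ss; move: ps; rewrite -/L; lra.
have RSq : ~ RS (ratr q) x.
  by move=> /(sup_upper_bound hS); rewrite -/L leNgt q1.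
have [d1 d10 h1] : exists2 d, 0 < d & forall s t, `|s| < d -> `|t| < d -> s <= t ->
      ratr p * (t - s) <= h (x + t *: v) - h (x + s *: v).
  have [[k k0 hk]|[k k0 /(_ x (eball_center _ k0))//]] := hx (inl p).
  by have [d ? hd] := up _ k k0 hk; exists d => //; apply: hd.
have [d2 d20 h2] : exists2 d, 0 < d & forall s t, `|s| < d -> `|t| < d -> s <= t ->
      h (x + t *: v) - h (x + s *: v) <= ratr q * (t - s).
  have [[k k0 /(_ x (eball_center _ k0))//]|[k k0 hk]] := hx (inl q).
  by have [d ? hd] := dn _ k k0 hk; exists d => //; apply: hd.
exists (Num.min d1 d2); split; first by rewrite lt_min d10.
move=> t; rewrite lt_min => /andP[t1 t2].
have [t0|t0] := leP 0 t.
  have := h1 0 t (d0 _ d10) t1 t0; have := h2 0 t (d0 _ d20) t2 t0.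
  rewrite !subr0 scale0r addr0 => a b.
  have : (L - ratr p) * t <= e * t by rewrite ler_wpM2r//; lra.
  have : (ratr q - L) * t <= e * t by rewrite ler_wpM2r//; lra.
  by move=> ? ?; rewrite (ger0_norm t0) ler_norml; apply/andP; lra.
have := h1 t 0 t1 (d0 _ d10) (ltW t0); have := h2 t 0 t2 (d0 _ d20) (ltW t0).
rewrite !sub0r scale0r addr0 => a b.
have : (L - ratr p) * (- t) <= e * (- t) by rewrite ler_wpM2r//; lra.
have : (ratr q - L) * (- t) <= e * (- t) by rewrite ler_wpM2r//; lra.
by move=> ? ?; rewrite (ltr0_norm t0) ler_norml; apply/andP; lra.
Qed.

Lemma dder_exists_open h v V : definable_fun D h ->
  open V -> V !=set0 -> (forall x, V x -> cont_at h x) ->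
  exists V', [/\ open V', V' !=set0, V' `<=` V &
    forall x, V' x -> exists c, has_dder h v x c].
Proof.
move=> dh oV V0 hc.
have dP : D n [set x | exists c, has_dder h v x c].
  by rewrite /has_dder; definability hD.
apply: (dense_definable_open dP) => //.
move=> W oW W0 WV; apply: dder_exists_generic => // x /WV; exact: hc.
Qed.

(** Given the value 0 where there is no derivative, so as to be a total function with a definable
    graph. *)
Definition dder h v x : R := xget 0 [set c | has_dder h v x c].

Lemma dderP h v x c : has_dder h v x c -> has_dder h v x (dder h v x).
Proof. by move=> hc; apply: (xgetPex 0 (P := [set c | has_dder h v x c])); exists c. Qed.

Lemma definable_dder h v : definable_fun D h -> definable_fun D (dder h v).
Proof.
move=> dh; rewrite /definable_fun.
have -> : [set z : 'rV[R]_(n + 1) | rsubmx z 0 0 = dder h v (lsubmx z)] =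
   [set z | has_dder h v (lsubmx z) (rsubmx z 0 0) \/
     (~ exists c, has_dder h v (lsubmx z) c) /\ rsubmx z 0 0 = 0].
  apply/seteqP; split => z /=.
    move=> ->; have [[c hc]|nc] := pselect (exists c, has_dder h v (lsubmx z) c).
      by left; exact: dderP hc.
    right; split => //; rewrite /dder xgetPN// => c hc.
    by apply: nc; exists c.
  move=> [hc|[nc ->]]; first exact: has_dder_unique hc (dderP hc).
  by rewrite /dder xgetPN// => c hc; apply: nc; exists c.
by rewrite /has_dder; definability hD.
Qed.

Lemma dder_continuous_open h v V : definable_fun D h ->
  open V -> V !=set0 -> (forall x, V x -> cont_at h x) ->
  exists V', [/\ open V', V' !=set0, V' `<=` V &
    forall x, V' x -> has_dder h v x (dder h v x) /\ cont_at (dder h v) x].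
Proof.
move=> dh oV V0 hc.
have [V1 [oV1 V10 V1V hV1]] := dder_exists_open v dh oV V0 hc.
have [V2 [oV2 V20 V2V hV2]] := definable_continuous_open (definable_dder v dh) oV1 V10.
exists V2; split => //; first exact: subset_trans V1V.
move=> x V2x; split; last exact: hV2.
by have [c hc'] := hV1 _ (V2V _ V2x); exact: dderP hc'.
Qed.

End GenericDifferentiability.

(** * Continuous partial derivatives and the Jacobian *)

Section PartialDerivatives.
Variables (R : realType) (n : nat).
Implicit Types (h : 'rV[R]_n -> R) (x z : 'rV[R]_n) (V : set 'rV[R]_n).

Lemma enorm_le_coord (u z : 'rV[R]_n) :
  (forall i, `|u 0 i| <= `|z 0 i|) -> enorm u <= enorm z.
Proof.
move=> uz; rewrite -(ler_pXn2r (n := 2)) ?nnegrE ?enorm_ge0// !enorm_sqr.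
apply: ler_sum => i _.
by rewrite -!expr2 -[leLHS]real_normK ?num_real// -[leRHS]real_normK ?num_real// lerXn2r ?nnegrE.
Qed.

(** The vertices of the path from 0 to [z] that changes one coordinate at a time; it serves the
    total derivative here and the Lipschitz bound of averages later. *)
Definition head_row k z : 'rV[R]_n := \row_i (if (i < k)%N then z 0 i else 0).

Lemma head_row0 z : head_row 0 z = 0.
Proof. by apply/rowP => i; rewrite !mxE. Qed.

Lemma head_row_full z : head_row n z = z.
Proof. by apply/rowP => i; rewrite !mxE ltn_ord. Qed.

Lemma head_rowS (k : 'I_n) z : head_row k.+1 z = head_row k z + z 0 k *: delta_mx 0 k.
Proof.
apply/rowP => i; rewrite !mxE eqxx /= ltnS leq_eqVlt.
have [->|ik] := eqVneq i k; first by rewrite eqxx ltnn mulr1 add0r.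
by rewrite (inj_eq val_inj) (negbTE ik) mulr0 addr0.
Qed.

Lemma enorm_head_row_segment (k : 'I_n) z t : 0 <= t <= 1 ->
  enorm (head_row k z + t *: (z 0 k *: delta_mx 0 k)) <= enorm z.
Proof.
move=> /andP[t0 t1]; apply: enorm_le_coord => i; rewrite !mxE eqxx /=.
have [->|ik] := eqVneq i k.
  by rewrite ltnn add0r mulr1 normrM ger0_norm// ler_piMl.
by rewrite !mulr0 addr0; case: ifP => //; rewrite normr0.
Qed.

Lemma common_radius (I : finType) (P : I -> 'rV[R]_n -> Prop) x :
  (forall i, exists2 r, 0 < r & forall y, eball x r y -> P i y) ->
  exists2 r, 0 < r & forall y, eball x r y -> forall i, P i y.
Proof.
move=> hP.
have H : forall s : seq I, exists2 r, 0 < r & forall y, eball x r y ->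
    forall i, i \in s -> P i y.
  elim => [|i s [r r0 hr]]; first by exists 1.
  have [r' r'0 hr'] := hP i; exists (Num.min r r'); first by rewrite lt_min r0.
  move=> y yr j; rewrite inE => /orP[/eqP->|js].
    by apply: hr'; apply: eball_le yr; rewrite ge_min lexx orbT.
  by apply: hr => //; apply: eball_le yr; rewrite ge_min lexx.
have [r r0 hr] := H (enum I); exists r => // y /hr hy i.
by apply: hy; rewrite mem_enum.
Qed.

(** The increment telescopes along the path of the [head_row k z]. On each edge the mean value
    inequality compares it with the partial derivative at [x], from which the partial derivatives on
    the edge differ by at most [e]. *)
Lemma total_derivative h V x (d : 'I_n -> 'rV[R]_n -> R) : open V -> V x ->
  (forall y, V y -> cont_at h y) ->
  (forall y i, V y -> has_dder h (delta_mx 0 i) y (d i y)) ->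
  (forall i, cont_at (d i) x) ->
  forall e, 0 < e -> exists2 r, 0 < r & forall z, enorm z < r ->
    `|h (x + z) - h x - \sum_i z 0 i * d i x| <= e * \sum_i `|z 0 i|.
Proof.
move=> /open_eballP oV Vx hc hd dc e e0.
have [r0 r00 hr0] := oV x Vx.
have [r1 r10 hr1] : exists2 r, 0 < r & forall y, eball x r y ->
    forall i, `|d i y - d i x| <= e.
  apply: common_radius => i; have [k [k0 hk]] := dc i e e0.
  by exists k => // y /hk/ltW.
pose r := Num.min r0 r1.
have r_gt0 : 0 < r by rewrite lt_min r00.
have rr0 : r <= r0 by rewrite ge_min lexx.
have hr i y : eball x r y -> `|d i y - d i x| <= e.
  by move=> yr; apply: hr1; apply: eball_le yr; rewrite ge_min lexx orbT.
exists r => // z zr.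
have -> : h (x + z) - h x = \sum_(k < n) (h (x + head_row k.+1 z) - h (x + head_row k z)).
  rewrite -(big_mkord xpredT (fun k => h (x + head_row k.+1 z) - h (x + head_row k z))).
  by rewrite telescope_sumr// head_row_full head_row0 addr0.
rewrite -sumrB mulr_sumr; apply: (le_trans (ler_norm_sum _ _ _)).
apply: ler_sum => k _; rewrite head_rowS addrA.
have inr t : 0 <= t <= 1 -> eball x r (x + head_row k z + t *: (z 0 k *: delta_mx 0 k)).
  move=> t01; rewrite /eball /= -(addrA x) (addrC x) addrK.
  by apply: le_lt_trans zr; exact: enorm_head_row_segment.
have inV t : 0 <= t <= 1 -> V (x + head_row k z + t *: (z 0 k *: delta_mx 0 k)).
  by move=> /inr/(eball_le rr0)/hr0.
apply: dder_slope_approx => t t01; first exact/hc/inV.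
exists (z 0 k * d k (x + head_row k z + t *: (z 0 k *: delta_mx 0 k))).
  exact/has_dderZ/hd/inV.
by rewrite -mulrBr normrM mulrC ler_wpM2r// hr//; exact: inr.
Qed.

Variables (f : 'rV[R]_n -> 'rV[R]_n) (V : set 'rV[R]_n) (J : 'rV[R]_n -> 'M[R]_n).
Hypothesis oV : open V.
Hypothesis fV : forall y j, V y -> cont_at (fun y => f y 0 j) y.
Hypothesis JV : forall y i j, V y ->
  has_dder (fun y => f y 0 j) (delta_mx 0 i) y (J y i j).
Hypothesis Jc : forall y i j, V y -> cont_at (fun y => J y i j) y.

Lemma linear_approx x : V x -> forall e, 0 < e -> exists2 r, 0 < r &
  forall z, enorm z < r -> forall j, `|(f (x + z) - f x - z *m J x) 0 j| <= e * `|z|.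
Proof.
move=> Vx e e0.
have n1 : 0 < n%:R + 1 :> R by rewrite ltr_wpDl.
have e'0 : 0 < e / (n%:R + 1) by rewrite divr_gt0.
have [r r0 hr] : exists2 r, 0 < r & forall z, eball 0 r z ->
    forall j, `|(f (x + z) - f x - z *m J x) 0 j| <= e * `|z|.
  apply: common_radius => j.
  have [r r0 hr] := total_derivative oV Vx (fun y => @fV y j)
    (fun y i => @JV y i j) (fun i => Jc i j Vx) e'0.
  exists r => // z; rewrite /eball /= subr0 => zr.
  have := hr z zr; rewrite !mxE => /le_trans; apply.
  apply: (@le_trans _ _ (e / (n%:R + 1) * (n%:R * `|z|))).
    apply: ler_wpM2l; first exact: ltW.
    have -> : n%:R * `|z| = \sum_(i < n) `|z| by rewrite sumr_const card_ord mulr_natl.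
    by apply: ler_sum => i _; exact: normr_coord_norm.
  rewrite mulrA ler_wpM2r// -mulrA ler_piMr//; first exact: ltW.
  by rewrite mulrC ler_pdivrMr// mul1r lerDl.
by exists r => // z zr j; apply: hr; rewrite /eball /= subr0.
Qed.

Lemma differentiable_from_partials x : V x ->
  differentiable f x /\ 'd f x = mulmxr (J x) :> ('rV[R]_n -> 'rV[R]_n).
Proof.
move=> Vx.
have cJ : continuous (mulmxr (J x) : 'rV[R]_n -> 'rV[R]_n).
  move=> y; apply/eball_continuousP => e e0.
  pose C := \sum_j \sum_i `|J x i j|.
  have C1 : 0 < C + 1 by rewrite ltr_wpDl// sumr_ge0// => j _; exact: sumr_ge0.
  exists (e / (C + 1)); first exact: divr_gt0.
  move=> z; rewrite /eball /= ltr_pdivlMr// => hz; rewrite -mulmxBl.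
  apply: le_lt_trans hz; apply: (le_trans (enorm_le_sum _)).
  apply: (@le_trans _ _ (enorm (z - y) * C)); last first.
    by rewrite ler_wpM2l ?enorm_ge0// lerDl.
  rewrite mulr_sumr; apply: ler_sum => j _.
  rewrite mxE mulr_sumr; apply: (le_trans (ler_norm_sum _ _ _)).
  apply: ler_sum => i _; rewrite normrM ler_wpM2r//; exact: normr_coord_le.
have E : f \o shift x = cst (f x) + mulmxr (J x) +o_ (nbhs (0 : 'rV[R]_n)) id.
  apply/eqaddoP => e e0.
  have [r r0 hr] := linear_approx Vx e0.
  apply/nbhs_eballP; exists r => // z; rewrite /eball /= subr0 => zr.
  rewrite -[leLHS]/`|_| [leLHS]/Num.norm /= mx_normrE; apply/bigmax_leP; split.
    by rewrite mulr_ge0// ltW.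
  move=> -[i j] _ /=; rewrite ord1.
  by have := hr z zr j; rewrite (addrC x) !mxE opprD addrA.
have dE := diff_unique cJ E.
split => //; apply/diff_locallyP; rewrite dE; split => //.
Qed.

Lemma jacobian_from_partials x : V x -> jacobian f x = J x.
Proof.
move=> Vx; have [_ E] := differentiable_from_partials Vx.
apply/row_matrixP => i; rewrite rowE /jacobian mul_rV_lin1.
exact: etrans (congr1 (@^~ (delta_mx 0 i)) E) (esym (rowE i (J x))).
Qed.

Lemma C1_near_from_partials x : V x -> C1_near f x.
Proof.
move=> Vx; exists V; split; [exact: oV|exact: Vx|move=> y Vy|move=> y Vy].
  by have [] := differentiable_from_partials Vy.
have jE z : V z -> deriv_mx f z = (J z)^T.
  by move=> Vz; rewrite /deriv_mx jacobian_from_partials.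
move=> A /nbhs_ballP[e e0 he].
have [r r0 hr] : exists2 r, 0 < r & forall z, eball y r z ->
    forall ij : 'I_n * 'I_n, `|J y ij.1 ij.2 - J z ij.1 ij.2| < e.
  apply: common_radius => -[i j]; have [r [r0 hr]] := Jc i j Vy e0.
  by exists r => // z /hr; rewrite distrC.
have [r' r'0 hr'] := open_eball oV Vy.
apply/nbhs_eballP; exists (Num.min r r'); first by rewrite lt_min r0.
move=> z zr; apply: he.
have zr1 : eball y r z by apply: eball_le zr; rewrite ge_min lexx.
have zr2 : V z by apply: hr'; apply: eball_le zr; rewrite ge_min lexx orbT.
rewrite jE// (jE z)//; split => // i j.
by rewrite -ball_normE /= !mxE; exact: (hr z zr1 (j, i)).
Qed.

Lemma has_dder_jacobian x v j : V x ->
  has_dder (fun y => f y 0 j) v x ((v *m jacobian f x) 0 j).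
Proof.
move=> Vx e e0; have v1 : 0 < `|v| + 1 by rewrite ltr_wpDl.
have [r r0 hr] := linear_approx Vx (divr_gt0 e0 v1).
have [d d0 hd] := near_segment 0 v r0.
exists d; split => // t td.
have := hd t td; rewrite /eball /= subr0 add0r => zr.
rewrite jacobian_from_partials//.
have -> : f (x + t *: v) 0 j - f x 0 j - (v *m J x) 0 j * t =
    (f (x + t *: v) - f x - (t *: v) *m J x) 0 j.
  by rewrite -scalemxAl !mxE [_ * t]mulrC.
apply: (le_trans (hr _ zr j)).
have -> : e / (`|v| + 1) * `|t *: v| = e * `|t| * (`|v| / (`|v| + 1)).
  by rewrite normrZ; ring.
rewrite ler_piMr//; first by rewrite mulr_ge0// ltW.
by rewrite ler_pdivrMr// mul1r lerDl.
Qed.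

End PartialDerivatives.

(** * Density of the points where a definable map is C^1 *)

Section GenericC1.
Variables (R : realType) (D : forall n, set (set 'rV[R]_n)).
Arguments D : clear implicits.
Hypothesis hD : o_minimal D.
Variable n : nat.

Lemma generic_partials (I : finType) (h : I -> 'rV[R]_n -> R) (v : I -> 'rV[R]_n)
    (V : set 'rV[R]_n) :
  (forall i, definable_fun D (h i)) -> open V -> V !=set0 ->
  (forall i x, V x -> cont_at (h i) x) ->
  exists V', [/\ open V', V' !=set0, V' `<=` V & forall x i, V' x ->
    has_dder (h i) (v i) x (dder (h i) (v i) x) /\ cont_at (dder (h i) (v i)) x].
Proof.
move=> dh oV V0 hc.
have H : forall s : seq I, exists V', [/\ open V', V' !=set0, V' `<=` V &
    forall x i, i \in s -> V' x ->
    has_dder (h i) (v i) x (dder (h i) (v i) x) /\ cont_at (dder (h i) (v i)) x].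
  elim => [|i s [V1 [ o1 n1 s1 h1]]]; first by exists V; split => // x i; rewrite in_nil.
  have [V2 [ o2 n2 s2 h2]] := dder_continuous_open hD (v i) (dh i) o1 n1
    (fun x V1x => hc i x (s1 _ V1x)).
  exists V2; split => //; first exact: subset_trans s1.
  move=> x j; rewrite inE => /orP[/eqP->|js] V2x; first exact: h2.
  by apply: h1 => //; exact: s2.
have [V' [? ? ? h']] := H (enum I); exists V'; split => // x i.
by apply: h'; rewrite mem_enum.
Qed.

(** [f] is definable only over its domain, so definability is carried by a total map [f0] that
    agrees with [f] on [V], while continuity and differentiability, being local, are stated for
    [f]. *)
Lemma C1_point (f f0 : 'rV[R]_n -> 'rV[R]_n) (V : set 'rV[R]_n) :
  definable_tmap D f0 -> open V -> V !=set0 ->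
  (forall x, V x -> f x = f0 x) -> (forall x, V x -> {for x, continuous f}) ->
  exists2 x, V x & C1_near f x /\
    forall v j, has_dder (fun y => f y 0 j) v x ((v *m jacobian f x) 0 j).
Proof.
move=> df oV V0 ff0 fc.
have fcj x j : V x -> cont_at (fun y => f y 0 j) x.
  move=> /fc/eball_continuousP h e /h[d d0 hd]; exists d; split => // y /hd.
  by apply: le_lt_trans; have := normr_coord_le (f y - f x) j; rewrite !mxE.
have near x : V x -> exists2 r, 0 < r & forall y, eball x r y -> f y = f0 y.
  by move=> /(open_eball oV)[r r0 hr]; exists r => // y /hr/ff0.
have f0c i x : V x -> cont_at (fun y => f0 y 0 i) x.
  move=> Vx; have [r r0 hr] := near x Vx.
  by apply: (cont_at_eq (h := fun y => f y 0 i) r0) (fcj x i Vx) => y /hr ->.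
have dfj (ij : 'I_n * 'I_n) : definable_fun D (fun y => f0 y 0 ij.2).
  by definability hD.
have [V' [oV' [x V'x] V'V hV']] := generic_partials
  (fun ij : 'I_n * 'I_n => delta_mx 0 ij.1) dfj oV V0 (fun ij => f0c ij.2).
pose J y : 'M[R]_n := \matrix_(i, j) dder (fun z => f0 z 0 j) (delta_mx 0 i) y.
have fV' y j : V' y -> cont_at (fun y => f y 0 j) y by move=> /V'V/fcj.
have JV' y i j : V' y -> has_dder (fun y => f y 0 j) (delta_mx 0 i) y (J y i j).
  move=> V'y; have [r r0 hr] := near y (V'V _ V'y); rewrite mxE.
  have [h _] := hV' y (i, j) V'y.
  by apply: has_dder_eq r0 _ h => z /hr ->.
have Jc y i j : V' y -> cont_at (fun y => J y i j) y.
  move=> V'y; have [_ h] := hV' y (i, j) V'y.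
  by apply: cont_at_eq ltr01 _ h => z _; rewrite mxE.
exists x; first exact: V'V.
split; first exact: C1_near_from_partials oV' fV' JV' Jc _ V'x.
by move=> v j; exact: has_dder_jacobian oV' fV' JV' Jc _ _ _ V'x.
Qed.

End GenericC1.

(** * Growth along a direction *)

Section Growth.
Variables (R : realType) (n : nat).
Implicit Types (h k : 'rV[R]_n -> R) (x v : 'rV[R]_n).

Lemma has_dder0 v x : has_dder (fun=> 0 : R) v x 0.
Proof.
move=> e e0; exists 1; split => // t _.
by rewrite mul0r !subr0 normr0 mulr_ge0// ltW.
Qed.

Lemma has_dderD h k v x c d :
  has_dder h v x c -> has_dder k v x d -> has_dder (fun y => h y + k y) v x (c + d).
Proof.
move=> hc kd e e0; have e20 : 0 < e / 2 by rewrite divr_gt0.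
have [r [r0 hr]] := hc _ e20; have [s [s0 hs]] := kd _ e20.
exists (Num.min r s); split; first by rewrite lt_min r0.
move=> t; rewrite lt_min => /andP[/hr h1 /hs h2].
have -> : h (x + t *: v) + k (x + t *: v) - (h x + k x) - (c + d) * t =
  (h (x + t *: v) - h x - c * t) + (k (x + t *: v) - k x - d * t) by ring.
apply: (le_trans (ler_normD _ _)); lra.
Qed.

Lemma has_dderM a h v x c : has_dder h v x c -> has_dder (fun y => a * h y) v x (a * c).
Proof.
move=> hc e e0; have a1 : 0 < `|a| + 1 by rewrite ltr_wpDl.
have [d [d0 hd]] := hc _ (divr_gt0 e0 a1).
exists d; split => // t /hd ht.
have -> : a * h (x + t *: v) - a * h x - a * c * t = a * (h (x + t *: v) - h x - c * t).
  by ring.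
rewrite normrM; apply: (@le_trans _ _ ((`|a| + 1) * (e / (`|a| + 1) * `|t|))).
  by apply: ler_pM => //; rewrite lerDl.
by rewrite mulrA (mulrC _ (e / _)) divfK ?gt_eqF.
Qed.

Lemma has_dder_dot u (f : 'rV[R]_n -> 'rV[R]_n) v x (c : 'rV[R]_n) :
  (forall j, has_dder (fun y => f y 0 j) v x (c 0 j)) ->
  has_dder (fun y => dot u (f y)) v x (dot u c).
Proof.
rewrite /dot => hf; elim: (index_enum _) => [|j s IH].
  by under eq_fun do rewrite big_nil; rewrite big_nil; exact: has_dder0.
under eq_fun do rewrite big_cons; rewrite big_cons.
exact: has_dderD (has_dderM (u 0 j) (hf j)) IH.
Qed.

Lemma eball_convex (z x y : 'rV[R]_n) r t : eball z r x -> eball z r y -> 0 <= t <= 1 ->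
  eball z r ((1 - t) *: x + t *: y).
Proof.
rewrite /eball /= => xr yr /andP[t0 t1].
have -> : (1 - t) *: x + t *: y - z = (1 - t) *: (x - z) + t *: (y - z).
  by rewrite !scalerBr addrACA -opprD -scalerDl subrK scale1r.
apply: (le_lt_trans (enormD _ _)); rewrite !enormZ !ger0_norm ?subr_ge0//.
have [->|tn0] := eqVneq t 0; first by rewrite subr0 mul1r mul0r addr0.
have tp : 0 < t by rewrite lt_def tn0.
have h1 : t * enorm (y - z) < t * r by rewrite ltr_pM2l.
have h2 : (1 - t) * enorm (x - z) <= (1 - t) * r by rewrite ler_wpM2l ?subr_ge0// ltW.
lra.
Qed.

Lemma eball_segment (z x v : 'rV[R]_n) r s t : eball z r x -> eball z r (x + t *: v) ->
  0 <= s <= t -> eball z r (x + s *: v).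
Proof.
move=> xr yr /andP[s0 st].
have [t0|tn0] := eqVneq t 0.
  have -> : s = 0 by lra.
  by rewrite scale0r addr0.
have tp : 0 < t by rewrite lt_def tn0 (le_trans s0 st).
have st1 : 0 <= s / t <= 1.
  by apply/andP; split; [exact: divr_ge0 s0 (ltW tp)|rewrite ler_pdivrMr// mul1r].
have := eball_convex xr yr st1.
by rewrite scalerDr scalerA divfK// addrA -scalerDl subrK scale1r.
Qed.

Lemma cont_at_dot u (f : 'rV[R]_n -> 'rV[R]_n) x :
  {for x, continuous f} -> cont_at (fun y => dot u (f y)) x.
Proof.
move=> /eball_continuousP h e e0; have u1 : 0 < enorm u + 1 by rewrite ltr_wpDl ?enorm_ge0.
have [d d0 hd] := h _ (divr_gt0 e0 u1); exists d; split => // y /hd.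
rewrite ltr_pdivlMr// -dotBr; apply: le_lt_trans.
apply: (le_trans (normr_dot_le _ _)); rewrite mulrC ler_wpM2l ?enorm_ge0// lerDl//.
Qed.

Variable D : forall n, set (set 'rV[R]_n).
Arguments D : clear implicits.
Hypothesis hD : o_minimal D.

Definition right_slope_lt h v (p : R) x := exists e, 0 < e /\
  forall t, 0 < t -> t < e -> h (x + t *: v) - h x < p * t.

Lemma right_slope_ltVge h v p x : definable_fun D h ->
  right_slope_lt h v p x \/ right_slope_ge h v p x.
Proof.
move=> dh; have [?|/(right_slope_dichotomy hD dh)[e e0 he]] := pselect (right_slope_ge h v p x).
  by right.
by left; exists e; split => // t t0 te; apply: he; rewrite ?add0r.
Qed.

Lemma right_slope_ge_eventually h v p x s : right_slope_ge h v p (x + s *: v) ->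
  eventually_right s (fun t => p * (t - s) <= h (x + t *: v) - h (x + s *: v)).
Proof.
move=> [e [e0 he]]; exists e => // t st te; have := he (t - s).
by rewrite line_shift subr_gt0; apply => //; lra.
Qed.

(* The parameters where the right slope is below [p] form a definable subset of
   the line. If it had empty interior it would be empty, by continuity of [h],
   and [h] would grow with slope at least [p] along the segment. *)
Lemma rational_right_slope_lt h v (p : R) x (t : R) : definable_fun D h -> 0 <= t ->
  (forall s, 0 <= s <= t -> cont_at h (x + s *: v)) ->
  h (x + t *: v) - h x < p * t ->
  exists2 q : rat, 0 <= (ratr q : R) <= t & right_slope_lt h v p (x + ratr q *: v).
Proof.
move=> dh t0 hc lt.
have [s st sN] : exists2 s, 0 <= s < t & right_slope_lt h v p (x + s *: v).
  apply: contrapT => /forall2NP nN.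
  have : p * (t - 0) <= h (x + t *: v) - h (x + 0 *: v).
    apply: slope_ge => // s st; apply: right_slope_ge_eventually.
    by have [//|] := right_slope_ltVge v p (x + s *: v) dh; have [] := nN s.
  by rewrite subr0 scale0r addr0 leNgt lt.
have dN : D 1 [set z : 'rV[R]_1 | right_slope_lt h v p (x + z 0 0 *: v)].
  by rewrite /right_slope_lt; definability hD.
have /andP[s0 lts] := st.
have [[e e0 he]|[e e0 he]] := definable_right_decided hD dN s.
  have [q] : exists q, ratr q \in `]s, (Num.min t (s + e))[.
    by apply: rat_in_itvoo; rewrite lt_min lts ltrDl.
  rewrite in_itv /= lt_min => /andP[q1 /andP[q2 q3]].
  exists q; first by apply/andP; lra.
  by have := he _ q1 q3; rewrite /= mxE.
(* Here no right slope is below [p] just to the right of [s], although it is below [p] at [s]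
   itself. Then [h] has slope at least [p] from [a] to [s + m] for every [a] slightly above [s], and
   letting [a] approach [s] contradicts the deficit [w] of the increment from [s] to [s + m]. *)
exfalso; have [d [d0 hd]] := sN.
pose m := Num.min (Num.min e d) (t - s) / 2.
have M0 : 0 < Num.min (Num.min e d) (t - s) by rewrite !lt_min e0 d0 subr_gt0.
have m0 : 0 < m by rewrite divr_gt0.
have : m < Num.min (Num.min e d) (t - s) by rewrite /m; lra.
rewrite !lt_min => /andP[/andP[me md] mt].
have := hd m m0 md; rewrite -addrA -scalerDl => lt2.
pose w := p * m - (h (x + (s + m) *: v) - h (x + s *: v)).
have w0 : 0 < w by rewrite subr_gt0.
have [|k k0 hk] := cont_at_line p hc (s := s) _ w0; first by apply/andP; lra.
pose a := s + Num.min k m / 2.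
have K0 : 0 < Num.min k m by rewrite lt_min k0.
have : Num.min k m / 2 < Num.min k m by lra.
rewrite lt_min => /andP[a1 a2].
have : p * (s + m - a) <= h (x + (s + m) *: v) - h (x + a *: v).
  apply: slope_ge; first by rewrite /a; lra.
    by move=> b /andP[b1 b2]; apply: hc; apply/andP; rewrite /a in b1; lra.
  move=> b /andP[b1 b2]; apply: right_slope_ge_eventually.
  have [bN|//] := right_slope_ltVge v p (x + b *: v) dh.
  by have := he b; rewrite /= mxE => H; exfalso; apply: H => //; rewrite /a in b1; lra.
have := hk a; rewrite /w /a => hk'.
have /hk' {hk'} : 0 <= s + Num.min k m / 2 <= t by apply/andP; lra.
have -> : s + Num.min k m / 2 - s = Num.min k m / 2 by ring.
by rewrite gtr0_norm ?divr_gt0// => /(_ a1); rewrite ltr_norml => /andP[]; lra.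
Qed.

Variables (f f0 : 'rV[R]_n -> 'rV[R]_n) (z : 'rV[R]_n) (r : R).
Hypothesis df0 : definable_tmap D f0.
Hypothesis ff0 : forall x, eball z r x -> f x = f0 x.
Hypothesis fc : forall x, eball z r x -> {for x, continuous f}.

(** A deficit on the segment from [x] persists for all nearby starting points [y]. A generic [y]
    decides, for every rational [q], whether the right slope at [y + q v] is below [p]; the previous
    lemma finds such a [q], so the right slope is below [p] on an open set. Rational positions are
    what keeps the family countable. *)
Lemma directional_growth (u v : 'rV[R]_n) (c : R) :
  (forall y, eball z r y -> C1_near f y -> c <= dot u (v *m jacobian f y)) ->
  forall x t, 0 <= t -> eball z r x -> eball z r (x + t *: v) ->
    c * t <= dot u (f (x + t *: v) - f x).
Proof.
move=> hJ x t t0 xB xtB.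
have [->|tn0] := eqVneq t 0; first by rewrite mulr0 scale0r addr0 subrr dot0r.
have tp : 0 < t by rewrite lt_def tn0.
rewrite leNgt; apply/negP => lt.
pose g y := dot u (f0 y).
have dg : definable_fun D g.
  by apply: definable_fun_sum => // j; definability hD.
have Bopen := @eball_open R n z r.
have gc y : eball z r y -> cont_at g y.
  move=> yB; have [d d0 hd] := open_eball Bopen yB.
  by apply: cont_at_eq d0 _ (cont_at_dot u (fc yB)) => w /hd/ff0 ->.
(* Half of the deficit per unit length: with [p = c - eta] there is still a deficit, and at a C^1
   point an error of [eta] on a derivative at least [c] leaves a slope at least [p]. *)
pose eta := (c * t - dot u (f (x + t *: v) - f x)) / (2 * t).
have eta0 : 0 < eta by rewrite divr_gt0 ?subr_gt0// mulr_gt0.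
pose p := c - eta.
have lt' : g (x + t *: v) - g x < p * t.
  rewrite /g -dotBr -(ff0 xB) -(ff0 xtB) /p mulrBl.
  have -> : eta * t = (c * t - dot u (f (x + t *: v) - f x)) / 2.
    by rewrite /eta invfM mulrA divfK.
  lra.
have [rho rho0 hrho] : exists2 rho, 0 < rho & forall y, eball x rho y ->
    [/\ eball z r y, eball z r (y + t *: v) & g (y + t *: v) - g y < p * t].
  have w0 : 0 < (p * t - (g (x + t *: v) - g x)) / 2 by rewrite divr_gt0// subr_gt0.
  have [d1 [d10 h1]] := gc x xB _ w0; have [d2 [d20 h2]] := gc _ xtB _ w0.
  have [d3 d30 h3] := open_eball Bopen xB.
  have [d4 d40 h4] := open_eball Bopen xtB.
  exists (Num.min (Num.min d1 d2) (Num.min d3 d4)).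
    by rewrite !lt_min d10 d20 d30.
  move=> y; rewrite /eball /= !lt_min => /andP[/andP[y1 y2] /andP[y3 y4]].
  have E : y + t *: v - (x + t *: v) = y - x by rewrite opprD addrACA subrr addr0.
  split; [exact: h3|by apply: h4; rewrite /eball /= E|].
  have := h1 y y1; have := h2 (y + t *: v); rewrite E => /(_ y2).
  rewrite !ltr_norml => /andP[a1 a2] /andP[a3 a4]; lra.
pose Z (q : rat) := [set y | right_slope_lt g v p (y + ratr q *: v)].
have dZ q : D n (Z q) by rewrite /Z /right_slope_lt; definability hD.
have [y yU hy] := generic_point hD dZ (@eball_open R n x rho)
  (ex_intro _ x (eball_center x rho0)).
have [yB ytB ylt] := hrho y yU.
have ysB s : 0 <= s <= t -> eball z r (y + s *: v) by exact: eball_segment.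
have [q qt yN] := rational_right_slope_lt dg t0 (fun s st => gc _ (ysB s st)) ylt.
have [e e0 he] : exists2 e, 0 < e & eball y e `<=` Z q.
  by have [//|[e e0 /(_ y (eball_center y e0))]] := hy q.
pose V := eball (y + ratr q *: v) e `&` eball z r.
have VB w : V w -> eball z r w by case.
have [w [w1 w2] [wC1 wd]] := C1_point hD df0 (openI (@eball_open _ _ _ _) Bopen)
  (ex_intro _ _ (conj (eball_center _ e0) (ysB _ qt)))
  (fun w (Vw : V w) => ff0 (VB w Vw)) (fun w (Vw : V w) => fc (VB w Vw)).
have [k [k0 hk]] : right_slope_lt g v p w.
  have := he (w - ratr q *: v); rewrite /Z /= subrK; apply.
  by move: w1; rewrite /eball /= opprD addrA addrAC.
have gd : has_dder g v w (dot u (v *m jacobian f w)).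
  have [d d0 hd] := open_eball Bopen w2.
  by apply: has_dder_eq d0 _ (has_dder_dot u (wd v)) => a /hd/ff0 ->.
have [d [d0 hd]] := gd eta eta0.
pose s := Num.min k d / 2.
have M0 : 0 < Num.min k d by rewrite lt_min k0.
have s0 : 0 < s by rewrite divr_gt0.
have : s < Num.min k d by rewrite /s; lra.
rewrite lt_min => /andP[sk sd].
have := hk s s0 sk; have := hd s; rewrite gtr0_norm// => /(_ sd).
rewrite ler_norml => /andP[h1 _].
have : c * s <= dot u (v *m jacobian f w) * s by apply: ler_wpM2r; [exact: ltW|exact: hJ].
rewrite /p; lra.
Qed.

End Growth.

(** * Separation *)

Section Separation.
Variables (R : realType) (n : nat).
Implicit Types (S : set 'rV[R]_n) (u v x p : 'rV[R]_n).

Lemma enormB_ge u v : enorm u - enorm v <= enorm (u - v).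
Proof. by rewrite lerBlDr -{1}(subrK v u) enormD. Qed.

Lemma normr_enormB u v : `|enorm u - enorm v| <= enorm (u - v).
Proof. by rewrite ler_norml enormB_ge andbT lerNl opprB enormC enormB_ge. Qed.

Lemma cont_enormB p : continuous (fun x => enorm (x - p)).
Proof.
move=> x; apply/eball_continuousRP => e e0; exists e => // y; apply: le_lt_trans.
by apply: (le_trans (normr_enormB _ _)); rewrite opprB addrA subrK.
Qed.

Lemma compact_in_eball S p r : closed S -> (forall x, S x -> enorm (x - p) <= r) -> compact S.
Proof.
move=> cS hS; apply: bounded_closed_compact => //.
exists (r + enorm p); split; first exact: num_real.
move=> M rM x /hS xr /=; apply: (le_trans (norm_le_enorm _)).
by have := enormB_ge x p; lra.
Qed.

Lemma closed_le_enormB p r : closed [set x : 'rV[R]_n | enorm (x - p) <= r].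
Proof.
rewrite -openC; apply/open_eballP => x /= /negP; rewrite -ltNge => rx.
exists (enorm (x - p) - r); first by rewrite subr_gt0.
move=> y; rewrite /eball /= => yx; apply/negP; rewrite -ltNge.
by have := enorm_triangle x y p; rewrite (enormC x y); lra.
Qed.

Definition adherent S : set 'rV[R]_n :=
  [set x | forall e, 0 < e -> exists2 y, S y & enorm (y - x) < e].

Lemma closed_adherent S : closed (adherent S).
Proof.
rewrite -openC; apply/open_eballP => x /= /existsNP[e /not_implyP[e0 nx]].
exists (e / 2); first by rewrite divr_gt0.
move=> y; rewrite /eball /= => yx hy.
have [|w Sw wy] := hy (e / 2); first by rewrite divr_gt0.
by apply: nx; exists w => //; have := enorm_triangle w y x; lra.
Qed.

(** [v] is the direction of the point [p] of the closure of [S] nearest to the origin: moving from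
    [p] towards a point [s] of [S] cannot shorten it, so [dot p (s - p) >= 0]. The given unit vector
    [u] is the answer when [S] is empty. *)
Lemma unit_separation S u (d : R) : enorm u = 1 -> 0 < d ->
  (forall x y t, S x -> S y -> 0 <= t <= 1 -> S ((1 - t) *: x + t *: y)) ->
  (forall x, S x -> d <= enorm x) ->
  exists2 v, enorm v = 1 & forall x, S x -> d <= dot v x.
Proof.
move=> u1 d0 cS hS; have [[s0 Ss0]|S0] := pselect (S !=set0); last first.
  by exists u => // x Sx; exfalso; apply: S0; exists x.
(* Cutting the closure by a ball through [s0] makes it compact without losing the points nearest to
   the origin. *)
pose K := adherent S `&` [set x | enorm (x - 0) <= enorm s0].
have subK x : S x -> adherent S x.
  by move=> Sx e e0; exists x => //; rewrite subrr enorm0.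
have cK : compact K.
  apply: (@compact_in_eball _ 0 (enorm s0)) => [|x []//].
  by apply: closedI; [exact: closed_adherent|exact: closed_le_enormB].
have K0 : K !=set0 by exists s0; split; rewrite /= ?subr0//; exact: subK.
have [p] := EVT_min_rV K0 cK (continuous_subspaceT (cont_enormB (p := 0))).
rewrite inE => -[pS ps0] pmin.
have {}pmin x : adherent S x -> enorm p <= enorm x.
  move=> xS; have [xs|sx] := leP (enorm x) (enorm s0).
    by have := pmin x; rewrite !subr0; apply; rewrite inE; split => //=; rewrite subr0.
  by move: ps0; rewrite /= subr0 => /le_trans; apply; exact: ltW.
have dp : d <= enorm p.
  apply/ler_addgt0Pr => e e0; have [y Sy yp] := pS e e0.
  by have := hS y Sy; have := enormB_ge y p; lra.
have p0 : 0 < enorm p by exact: lt_le_trans dp.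
have key s : S s -> 0 <= dot p (s - p).
  move=> Ss; rewrite leNgt; apply/negP => neg.
  (* The squared norm at parameter [t] is [|p|^2 - 2 t a + t^2 |s - p|^2]. The choice [t = a / q]
     gives [t * |s - p|^2 = a - t * a < a], hence a strict decrease; the summand [a] of [q] ensures
     [t <= 1]. *)
  pose a := - dot p (s - p); pose q := enorm (s - p) ^+ 2 + a.
  have a0 : 0 < a by rewrite oppr_gt0.
  have q0 : 0 < q by rewrite ltr_wpDl// sqr_ge0.
  pose t := a / q; have t0 : 0 < t by rewrite divr_gt0.
  have t1 : t <= 1 by rewrite ler_pdivrMr// mul1r lerDr sqr_ge0.
  have xS : adherent S ((1 - t) *: p + t *: s).
    move=> e e0; have [y Sy yp] := pS e e0; exists ((1 - t) *: y + t *: s).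
      by apply: cS => //; rewrite ltW.
    rewrite opprD addrACA subrr addr0 -scalerBr enormZ ger0_norm ?subr_ge0//.
    apply: le_lt_trans yp; rewrite ler_piMl ?enorm_ge0//; lra.
  have := pmin _ xS.
  rewrite -(ler_pXn2r (n := 2)) ?nnegrE ?enorm_ge0// !enorm_sqr.
  have -> : (1 - t) *: p + t *: s = p + t *: (s - p).
    by rewrite scalerBl scale1r scalerBr addrAC addrA.
  rewrite dotDl !dotDr !dotZl !dotZr (dotC (s - p) p) -!enorm_sqr.
  have e1 : t * q = a by rewrite /t divfK ?gt_eqF.
  have e2 : dot p (s - p) = - a by rewrite /a opprK.
  have e3 : enorm (s - p) ^+ 2 = q - a by rewrite /q addrK.
  rewrite e2 e3 => h.
  have : 0 <= t * (- a - a + t * q - t * a) by move: h; lra.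
  by rewrite pmulr_rge0// e1; have := mulr_gt0 t0 a0; lra.
exists ((enorm p)^-1 *: p).
  by rewrite enormZ ger0_norm ?invr_ge0 ?enorm_ge0// mulVf// gt_eqF.
move=> s /key; rewrite dotBr subr_ge0 -enorm_sqr dotZl => h.
apply: (le_trans dp); rewrite mulrC ler_pdivlMr// -expr2//.
Qed.

Lemma enorm_tr m (x : 'cV[R]_m) : enorm x^T = enorm x.
Proof.
rewrite /enorm; congr Num.sqrt; rewrite big_ord1; apply: eq_bigr => i _.
by rewrite big_ord1 mxE.
Qed.

Lemma dot_mulmx u v (A : 'M[R]_n) : dot u (v *m A) = dot (u *m A^T) v.
Proof.
have E (a b : 'rV[R]_n) : dot a b = (a *m b^T) 0 0.
  by rewrite mxE; apply: eq_bigr => i _; rewrite mxE.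
by rewrite !E trmx_mul mulmxA.
Qed.

Definition expands (d : R) (A : 'M[R]_n) := forall v, d * enorm v <= enorm (v *m A).

(** [A] has trivial kernel, so [u = w *m A] for some [w] with [d * |w| <= |u|]. Then [|u|^2 = <u, w
    A> = <u A^T, w> <= |u A^T| * |w|], which gives the bound without singular values. *)
Lemma expands_tr d A : 0 < d -> expands d A -> expands d A^T.
Proof.
move=> d0 hA u.
have A_unit : A \in unitmx.
  rewrite -row_free_unit -kermx_eq0; apply/eqP/row_matrixP => i; rewrite row0.
  apply: enorm_eq0; apply/eqP; rewrite eq_le enorm_ge0 andbT.
  have := hA (row i (kermx A)); rewrite -row_mul mulmx_ker row0 enorm0.
  by rewrite pmulr_rle0.
have [->|u0] := eqVneq (enorm u) 0; first by rewrite mulr0 enorm_ge0.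
have up : 0 < enorm u by rewrite lt_def u0 enorm_ge0.
pose w := u *m invmx A.
have wA : w *m A = u by rewrite /w mulmxKV.
have h1 : enorm u ^+ 2 <= enorm (u *m A^T) * enorm w.
  by rewrite enorm_sqr -{2}wA dot_mulmx dot_le.
have h2 : d * enorm w <= enorm u by rewrite -[in leRHS]wA.
rewrite -(ler_pM2r up) -mulrA -expr2.
apply: (@le_trans _ _ (d * (enorm (u *m A^T) * enorm w))).
  by rewrite ler_wpM2l// ltW.
by rewrite mulrCA ler_wpM2l ?enorm_ge0.
Qed.

(** For fixed [v], the rows [v *m A] form a convex set at distance at least [d] from 0. *)
Lemma unit_separation_mx (C : set 'M[R]_n) (d : R) :
  0 < d -> (forall A B t, C A -> C B -> 0 <= t <= 1 -> C ((1 - t) *: A + t *: B)) ->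
  (forall A, C A -> expands d A) ->
  forall v, enorm v = 1 -> exists2 u, enorm u = 1 & forall A, C A -> d <= dot u (v *m A).
Proof.
move=> d0 cC hC v v1.
have [||u u1 hu] := @unit_separation [set v *m A | A in C] v d v1 d0.
- move=> _ _ t [A CA <-] [B CB <-] t01; exists ((1 - t) *: A + t *: B); first exact: cC.
  by rewrite mulmxDr -!scalemxAr.
- by move=> _ [A CA <-]; have := hC A CA v; rewrite v1 mulr1.
by exists u => // A CA; apply: hu; exists A.
Qed.

End Separation.

(** * Openness by averaging *)

Section Averaging.
Variables (R : realType) (n : nat).
Implicit Types (F f : 'rV[R]_n -> 'rV[R]_n) (x z u v w h : 'rV[R]_n) (C : set 'rV[R]_n).

(** Heine's theorem on a closed ball, except that only [x] is confined to the ball; [y] may lie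
    slightly outside. *)
Lemma uniform_continuity f z s : (forall x, enorm (x - z) <= s -> {for x, continuous f}) ->
  forall e, 0 < e -> exists2 d, 0 < d & forall x y, enorm (x - z) <= s ->
    enorm (y - x) < d -> enorm (f y - f x) < e.
Proof.
move=> fc e e0.
have cK : compact [set x | enorm (x - z) <= s].
  by apply: (@compact_in_eball _ _ _ z s) => //; exact: closed_le_enormB.
have := (compact_near_coveringP _).1 cK R (0^'+)
  (fun d x => forall y, enorm (y - x) < d -> enorm (f y - f x) < e).
move=> /(_ _)[].
  move=> x /fc/eball_continuousP cx.
  have e20 : 0 < e / 2 by rewrite divr_gt0.
  have [d d0 hd] := cx _ e20.
  exists (eball x (d / 2), [set t | t < d / 2]).
    split => /=; first by apply: nbhs_eball; rewrite divr_gt0.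
    by apply: nbhs_right_lt; rewrite divr_gt0.
  move=> [x' t] [/= xx' td] y yx'.
  have h1 := hd x'; have h2 := hd y.
  have xd : eball x d x' by move: xx'; rewrite /eball /=; lra.
  have yd : eball x d y.
    rewrite /eball /=; have := enorm_triangle y x' x.
    by move: xx'; rewrite /eball /=; lra.
  have := h1 xd; have := h2 yd; have := enorm_triangle (f y) (f x) (f x').
  by rewrite (enormC (f x)); lra.
move=> d /= d0 hd; exists (d / 2); first by rewrite divr_gt0.
move=> x y xs; apply: (hd (d / 2)) => //=; last by rewrite divr_gt0.
by rewrite sub0r normrN gtr0_norm ?divr_gt0//; move: d0; rewrite /=; lra.
Qed.

(** Oscillation bounds, Lipschitz bounds and growth are all of this kind, for a ball or a half-space
    [C]. Since these are closed under means, the averages inherit all of them in the same way. *)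
Definition increments z (s : R) F h C :=
  forall x, eball z s x -> eball z s (x + h) -> C (F (x + h) - F x).

Definition mean_closed C := forall N (w : 'I_N.+1 -> 'rV[R]_n),
  (forall j, C (w j)) -> C (N.+1%:R^-1 *: \sum_j w j).

Lemma mean_closed_enorm (c : R) : mean_closed [set w | enorm w <= c].
Proof.
move=> N w hw; rewrite /= enormZ ger0_norm ?invr_ge0// mulrC ler_pdivrMr ?ltr0n//.
have -> : c * N.+1%:R = \sum_(j < N.+1) c by rewrite sumr_const card_ord mulr_natr.
elim/big_ind2 : _ => [|a b a' b' h1 h2|j _]; last exact: hw.
  by rewrite enorm0.
by apply: (le_trans (enormD _ _)); exact: lerD.
Qed.

Lemma mean_closed_dot u (c : R) : mean_closed [set w | c <= dot u w].
Proof.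
move=> N w hw; rewrite /= dotZr mulrC ler_pdivlMr ?ltr0n//.
have -> : c * N.+1%:R = \sum_(j < N.+1) c by rewrite sumr_const card_ord mulr_natr.
elim/big_ind2 : _ => [|a b a' b' h1 h2|j _]; last exact: hw.
  by rewrite dot0r.
by rewrite dotDr; exact: lerD.
Qed.

Definition average v N F x := N.+1%:R^-1 *: \sum_(j < N.+1) F (x + j%:R *: v).

Section OneAverage.
Variables (z v : 'rV[R]_n) (s ep : R) (N : nat) (F : 'rV[R]_n -> 'rV[R]_n).
Hypothesis vN : N.+1%:R * enorm v <= ep.

Lemma average_domain x (j : nat) : (j <= N.+1)%N ->
  eball z (s - ep) x -> eball z s (x + j%:R *: v).
Proof.
move=> jN; rewrite /eball /= => xs.
have -> : x + j%:R *: v - z = (x - z) + j%:R *: v by rewrite addrAC.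
apply: (le_lt_trans (enormD _ _)); rewrite enormZ normr_nat.
have jv : j%:R * enorm v <= ep.
  by apply: le_trans vN; rewrite ler_wpM2r ?enorm_ge0// ler_nat.
by rewrite -ltrBrDr; apply: lt_le_trans xs _; rewrite lerB.
Qed.

Lemma average_increments h C : mean_closed C ->
  increments z s F h C -> increments z (s - ep) (average v N F) h C.
Proof.
move=> mC hF x xs xhs; rewrite /average -scalerBr -sumrB; apply: mC => j.
rewrite addrAC; apply: hF; first by apply: average_domain => //; exact: ltnW.
by rewrite addrAC; apply: average_domain => //; exact: ltnW.
Qed.

(** The translates are equally spaced by [v], so the increment along [v] telescopes to
    [(F (x + N.+1%:R *: v) - F x) / N.+1%:R]. The last translate used is the one of index [N.+1],
    which is why the domain shrinks by [N.+1%:R * enorm v]. *)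
Lemma average_step (M : R) : (forall h, increments z s F h [set w | enorm w <= M]) ->
  increments z (s - ep) (average v N F) v [set w | enorm w <= M / N.+1%:R].
Proof.
move=> hF x xs _; rewrite /average -scalerBr -sumrB.
have -> : \sum_(j < N.+1) (F (x + v + j%:R *: v) - F (x + j%:R *: v)) =
    F (x + N.+1%:R *: v) - F x.
  rewrite (eq_bigr (fun j : 'I_N.+1 => F (x + j.+1%:R *: v) - F (x + j%:R *: v))).
    rewrite -(big_mkord xpredT (fun j => F (x + j.+1%:R *: v) - F (x + j%:R *: v))).
    by rewrite (telescope_sumr (fun j => F (x + j%:R *: v)))// scale0r addr0.
  by move=> j _; rewrite -addrA -{1}(scale1r v) -scalerDl nat1r.
rewrite /= enormZ ger0_norm ?invr_ge0// mulrC ler_wpM2r ?invr_ge0//; apply: hF.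
  by have := average_domain (leq0n _) xs; rewrite scale0r addr0.
exact: average_domain xs.
Qed.

Lemma average_close (c : R) : (forall h, enorm h <= ep -> increments z s F h [set w | enorm w <= c]) ->
  forall x, eball z (s - ep) x -> enorm (average v N F x - F x) <= c.
Proof.
move=> hF x xs.
have -> : average v N F x - F x = N.+1%:R^-1 *: \sum_(j < N.+1) (F (x + j%:R *: v) - F x).
  rewrite sumrB scalerBr sumr_const card_ord -[F x *+ _]scaler_nat scalerA.
  by rewrite mulVf ?pnatr_eq0// scale1r.
apply: mean_closed_enorm => j; apply: hF.
- rewrite enormZ normr_nat; apply: le_trans vN.
  by rewrite ler_wpM2r ?enorm_ge0// ler_nat ltnW.
- by have := average_domain (leq0n _) xs; rewrite scale0r addr0.
- by apply: average_domain => //; exact: ltnW.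
Qed.

End OneAverage.

Lemma increments_iter z s F v (c : R) (m : nat) :
  increments z s F v [set w | enorm w <= c] ->
  increments z s F (m%:R *: v) [set w | enorm w <= m%:R * c].
Proof.
move=> hF; elim: m => [|m IH] x xs xms; first by rewrite /= scale0r addr0 subrr enorm0 mul0r.
have xm : eball z s (x + m%:R *: v).
  by apply: eball_segment xs xms _; rewrite ler0n ler_nat leqnSn.
have := IH x xs xm; have := hF _ xm.
have E : x + m%:R *: v + v = x + m.+1%:R *: v.
  by rewrite -addrA -{2}(scale1r v) -scalerDl natr1.
rewrite E /= => /(_ xms) h1 h2.
have -> : F (x + m.+1%:R *: v) - F x =
  (F (x + m.+1%:R *: v) - F (x + m%:R *: v)) + (F (x + m%:R *: v) - F x).
  by rewrite addrA subrK.
apply: (le_trans (enormD _ _)).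
by rewrite -[X in _ <= X * _]natr1 mulrDl mul1r addrC; exact: lerD.
Qed.

(* Averaging over [N + 1] translates by [eta *: e] turns a bound on the
   oscillation into a Lipschitz bound along [e] at scales larger than [eta]. *)
Lemma average_lipschitz z e s (eta ep M om : R) N F : 0 < eta -> enorm e = 1 ->
  N.+1%:R * eta = ep -> 0 <= M ->
  (forall h, increments z s F h [set w | enorm w <= M]) ->
  (forall h, enorm h <= eta -> increments z s F h [set w | enorm w <= om]) ->
  forall a, increments z (s - ep) (average (eta *: e) N F) (a *: e)
    [set w | enorm w <= M / ep * `|a| + om].
Proof.
move=> eta0 e1 Nep M0 hM hom.
have vN : N.+1%:R * enorm (eta *: e) <= ep by rewrite enormZ e1 mulr1 gtr0_norm// Nep.
have ep0 : 0 < ep by rewrite -Nep mulr_gt0.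
set G := average _ _ _.
have pos a : 0 <= a -> increments z (s - ep) G (a *: e) [set w | enorm w <= M / ep * `|a| + om].
  move=> a0 x xs xas.
  (* [a] splits into [m] whole steps of length [eta], each costing [M / N.+1%:R], that is
     [M / ep * eta], and a remainder shorter than [eta], costing [om]. *)
  pose m := Num.truncn (a / eta).
  have ae0 : 0 <= a / eta by rewrite divr_ge0// ltW.
  have /andP[m1 m2] : m%:R <= a / eta < m.+1%:R by exact: truncn_itv.
  have {}m1 : m%:R * eta <= a by rewrite -ler_pdivlMr.
  have {}m2 : a < m%:R * eta + eta by rewrite -[X in _ + X]mul1r -mulrDl natr1 -ltr_pdivrMr.
  have xm : eball z (s - ep) (x + m%:R *: (eta *: e)).
    by rewrite scalerA; apply: eball_segment xs xas _; rewrite m1 mulr_ge0// ltW.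
  have h1 := increments_iter (m := m) (average_step vN hM) xs xm.
  have E : x + m%:R *: (eta *: e) + (a - m%:R * eta) *: e = x + a *: e.
    by rewrite scalerA line_shift.
  have : enorm (G (x + a *: e) - G (x + m%:R *: (eta *: e))) <= om.
    have := average_increments vN (@mean_closed_enorm om)
      (hom ((a - m%:R * eta) *: e) _) xm; rewrite E; apply => //.
    by rewrite enormZ e1 mulr1 ger0_norm; lra.
  move: h1; rewrite -/G /= ger0_norm// => h1 h3.
  have -> : G (x + a *: e) - G x = (G (x + a *: e) - G (x + m%:R *: (eta *: e)))
     + (G (x + m%:R *: (eta *: e)) - G x) by rewrite addrA subrK.
  apply: (le_trans (enormD _ _)).
  have h4 : m%:R * (M / N.+1%:R) <= M / ep * a.
    have -> : m%:R * (M / N.+1%:R) = M / ep * (m%:R * eta).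
      rewrite -Nep; have : N.+1%:R != 0 :> R by rewrite pnatr_eq0.
      by move: (N.+1%:R) => K K0; field; rewrite K0 gt_eqF.
    by rewrite ler_wpM2l// divr_ge0// ltW.
  by rewrite addrC; apply: lerD h3; exact: le_trans h1 h4.
move=> a x xs xas; have [a0|a0] := leP 0 a; first exact: pos.
have := pos (- a) _ (x + a *: e) xas; rewrite scaleNr addrK normrN /= enormC.
by apply => //; rewrite oppr_ge0 ltW.
Qed.


Section IteratedAverage.
Variables (z : 'rV[R]_n) (s eta ep M om ka : R) (N : nat) (f : 'rV[R]_n -> 'rV[R]_n).
Hypotheses (eta0 : 0 < eta) (Nep : N.+1%:R * eta = ep) (M0 : 0 <= M).
Hypothesis fM : forall h, increments z s f h [set w | enorm w <= M].
Hypothesis fom : forall h, enorm h <= eta -> increments z s f h [set w | enorm w <= om].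
Hypothesis fka : forall h, enorm h <= ep -> increments z s f h [set w | enorm w <= ka].

(** One average is Lipschitz only along its own direction, so there is one per basis vector; the
    other averages preserve the bounds already obtained. *)
Definition averages (l : seq 'I_n) :=
  foldr (fun k F => average (eta *: delta_mx 0 k) N F) f l.

Lemma enorm_delta (k : 'I_n) : enorm (delta_mx 0 k : 'rV[R]_n) = 1.
Proof.
rewrite enorm_dot /dot (bigD1 k)//= mxE !eqxx mulr1 big1 ?addr0 ?sqrtr1// => j jk.
by rewrite mxE (negbTE jk) andbF mulr0.
Qed.

Lemma averages_increments l h C : mean_closed C -> increments z s f h C ->
  increments z (s - (size l)%:R * ep) (averages l) h C.
Proof.
move=> mC hf; elim: l => [|k l IH]; first by rewrite mul0r subr0.
have vN : N.+1%:R * enorm (eta *: delta_mx 0 k : 'rV[R]_n) <= ep.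
  by rewrite enormZ enorm_delta mulr1 gtr0_norm// Nep.
by rewrite /= -natr1 mulrDl mul1r opprD addrA; exact: average_increments.
Qed.

Lemma averages_close l x : eball z (s - (size l)%:R * ep) x ->
  enorm (averages l x - f x) <= (size l)%:R * ka.
Proof.
elim: l x => [|k l IH] x; first by move=> _; rewrite /= subrr enorm0 mul0r.
have vN : N.+1%:R * enorm (eta *: delta_mx 0 k : 'rV[R]_n) <= ep.
  by rewrite enormZ enorm_delta mulr1 gtr0_norm// Nep.
have ep0 : 0 < ep by rewrite -Nep mulr_gt0.
rewrite /= -natr1 !mulrDl !mul1r opprD addrA => xs.
have h1 := average_close vN (fun h hep =>
  averages_increments (l := l) (@mean_closed_enorm ka) (fka hep)) xs.
have h2 : enorm (averages l x - f x) <= (size l)%:R * ka.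
  by apply: IH; apply: eball_le xs; rewrite gerBl ltW.
by apply: (le_trans (enorm_triangle _ (averages l x) _)); rewrite addrC lerD.
Qed.

Lemma averages_lipschitz l k a : k \in l ->
  increments z (s - (size l)%:R * ep) (averages l) (a *: delta_mx 0 k)
    [set w | enorm w <= M / ep * `|a| + om].
Proof.
elim: l => // j l IH; rewrite inE.
have vN : N.+1%:R * enorm (eta *: delta_mx 0 j : 'rV[R]_n) <= ep.
  by rewrite enormZ enorm_delta mulr1 gtr0_norm// Nep.
rewrite /= -natr1 mulrDl mul1r opprD addrA => /orP[/eqP->|kl].
  apply: average_lipschitz => //; first exact: enorm_delta.
    by move=> h; apply: averages_increments => //; exact: mean_closed_enorm.
  by move=> h hh; apply: averages_increments; [exact: mean_closed_enorm|exact: fom].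
by apply: average_increments => //; [exact: mean_closed_enorm|exact: IH].
Qed.

Lemma averages_lipschitz_all x h r : enorm (x - z) <= r -> enorm h < r ->
  r + r <= s - n%:R * ep ->
  enorm (averages (enum 'I_n) (x + h) - averages (enum 'I_n) x) <=
    n%:R * (M / ep * enorm h + om).
Proof.
move=> xr hr rs; set F := averages _.
have ep0 : 0 < ep by rewrite -Nep mulr_gt0.
have sz : size (enum 'I_n) = n by rewrite size_enum_ord.
have -> : F (x + h) - F x =
    \sum_(k < n) (F (x + head_row k.+1 h) - F (x + head_row k h)).
  rewrite -(big_mkord xpredT (fun k => F (x + head_row k.+1 h) - F (x + head_row k h))).
  by rewrite (telescope_sumr (fun k => F (x + head_row k h)))// head_row_full head_row0 addr0.
have -> : n%:R * (M / ep * enorm h + om) = \sum_(k < n) (M / ep * enorm h + om).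
  by rewrite sumr_const card_ord mulr_natl.
have inB (k : nat) : eball z (s - n%:R * ep) (x + head_row k h).
  rewrite /eball /= addrAC; apply: (le_lt_trans (enormD _ _)).
  have : enorm (head_row k h) <= enorm h.
    by apply: enorm_le_coord => i; rewrite mxE; case: ifP; rewrite // normr0.
  lra.
have : forall k : 'I_n,
    enorm (F (x + head_row k.+1 h) - F (x + head_row k h)) <= M / ep * enorm h + om.
  move=> k; have := @averages_lipschitz (enum 'I_n) k (h 0 k); rewrite sz mem_enum.
  move=> /(_ isT _ (inB k)); rewrite -addrA -head_rowS => /(_ (inB _)) /le_trans; apply.
  by rewrite lerD2r ler_wpM2l ?divr_ge0 ?(ltW ep0)//; exact: normr_coord_le.
move=> H; elim/big_ind2 : _ => [|a b a' b' h1 h2|k _]; [by rewrite enorm0| |exact: H].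
by apply: (le_trans (enormD _ _)); exact: lerD.
Qed.

End IteratedAverage.

End Averaging.

(** * Openness of the image *)

Section OpenImage.
Variables (R : realType) (n : nat).
Implicit Types (f : 'rV[R]_n -> 'rV[R]_n) (x y z u v : 'rV[R]_n).

Lemma cont_at_enorm_subr f y x : {for x, continuous f} ->
  {for x, continuous (fun x => enorm (f x - y))}.
Proof.
move=> /eball_continuousP fx; apply/eball_continuousRP => e /fx[d d0 hd].
exists d => // w /hd; apply: le_lt_trans; apply: (le_trans (normr_enormB _ _)).
by rewrite opprB addrA subrK.
Qed.

Lemma enorm_subr_min f y z r : 0 <= r ->
  (forall x, enorm (x - z) <= r -> {for x, continuous f}) ->
  exists2 p, enorm (p - z) <= r &
    forall x, enorm (x - z) <= r -> enorm (f p - y) <= enorm (f x - y).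
Proof.
move=> r0 fc; pose K := [set x | enorm (x - z) <= r].
have cK : compact K by apply: (@compact_in_eball _ _ _ z r) => //; exact: closed_le_enormB.
have K0 : K !=set0 by exists z; rewrite /K /= subrr enorm0.
have [|p pK hp] := EVT_min_rV (f := fun x => enorm (f x - y)) K0 cK.
  by apply: continuous_in_subspaceT => x; rewrite inE => /fc fx; exact: cont_at_enorm_subr fx.
rewrite inE in pK; exists p => // x xK; apply: hp; by rewrite inE.
Qed.

Lemma bounded_on_eball f z r : 0 <= r ->
  (forall x, enorm (x - z) <= r -> {for x, continuous f}) ->
  exists2 M, 0 <= M & forall x y, enorm (x - z) <= r -> enorm (y - z) <= r ->
    enorm (f x - f y) <= M.
Proof.
move=> r0 fc; pose K := [set x | enorm (x - z) <= r].
have cK : compact K by apply: (@compact_in_eball _ _ _ z r) => //; exact: closed_le_enormB.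
have K0 : K !=set0 by exists z; rewrite /K /= subrr enorm0.
have [|p _ hp] := EVT_max_rV (f := fun x => enorm (f x - 0)) K0 cK.
  by apply: continuous_in_subspaceT => x; rewrite inE => /fc fx; exact: cont_at_enorm_subr fx.
exists (enorm (f p) + enorm (f p)); first by rewrite addr_ge0 ?enorm_ge0.
have hp' x : enorm (x - z) <= r -> enorm (f x) <= enorm (f p).
  by move=> xr; have := hp x; rewrite !subr0; apply; rewrite inE.
by move=> x y /hp' hx /hp' hy; apply: (le_trans (enormB _ _)); exact: lerD.
Qed.

Definition grows f (z : 'rV[R]_n) (r delta : R) u v :=
  forall t, 0 <= t -> increments z r f (t *: v) [set w | delta * t <= dot u w].

Lemma normalize x : enorm x != 0 -> exists2 v, enorm v = 1 & x = enorm x *: v.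
Proof.
move=> x0; exists ((enorm x)^-1 *: x).
  by rewrite enormZ ger0_norm ?invr_ge0 ?enorm_ge0// mulVf.
by rewrite scalerA divff// scale1r.
Qed.

Lemma grows_expands f z r delta :
  (forall v, enorm v = 1 -> exists2 u, enorm u = 1 & grows f z r delta u v) ->
  forall x y, eball z r x -> eball z r y -> delta * enorm (y - x) <= enorm (f y - f x).
Proof.
move=> hf x y xr yr; have [e0|e0] := eqVneq (enorm (y - x)) 0.
  by rewrite e0 mulr0 enorm_ge0.
have [v v1 yxE] := normalize e0.
have [u u1 hu] := hf v v1.
have yE : y = x + enorm (y - x) *: v by rewrite -yxE addrC subrK.
have := hu (enorm (y - x)) (enorm_ge0 _) x xr; rewrite -yE => /(_ yr) /le_trans; apply.
by apply: (le_trans (dot_le _ _)); rewrite u1 mul1r.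
Qed.

Section Hit.
Variables (f : 'rV[R]_n -> 'rV[R]_n) (z y : 'rV[R]_n) (rho delta : R).
Hypotheses (rho0 : 0 < rho) (delta0 : 0 < delta).
Hypothesis fc : forall x, enorm (x - z) <= 3 * rho -> {for x, continuous f}.
Hypothesis out : forall v, enorm v = 1 ->
  exists2 u, enorm u = 1 & grows f z (3 * rho) delta u v.
Hypothesis inw : forall u, enorm u = 1 ->
  exists2 v, enorm v = 1 & grows f z (3 * rho) delta u v.
Hypothesis yz : enorm (f z - y) < delta * rho / 8.

(** The order of the quantifiers is the point: [ka] fixes the width [ep] of the averages and thereby
    [L], whereas [t] fixes only the spacing [eta] of the translates. The radius drops from [3 * rho]
    to [2 * rho] by averaging; the last [rho] is room for the moves. *)
Lemma averaged_map (ka : R) : 0 < ka -> exists2 L : R, 0 <= L &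
  forall t, 0 < t < rho -> exists F : 'rV[R]_n -> 'rV[R]_n,
  [/\ forall h C, mean_closed C ->
        increments z (3 * rho) f h C -> increments z (2 * rho) F h C,
      forall x, enorm (x - z) <= rho -> enorm (F x - f x) <= ka &
      forall x h, enorm (x - z) <= rho -> enorm h <= t ->
        enorm (F (x + h) - F x) <= L * t].
Proof.
move=> ka0; have rho3 : 0 <= 3 * rho by rewrite mulr_ge0// ltW.
have n1 : 0 < n%:R + 1 :> R by rewrite ltr_wpDl.
have ka'0 : 0 < ka / (n%:R + 1) by rewrite divr_gt0.
have [M M0 hM] := bounded_on_eball rho3 fc.
have [d d0 hd] := uniform_continuity fc ka'0.
(* Below [d], each of the [n] averages moves values by at most [ka / (n + 1)]; below
   [rho / (n + 1)], together they shrink the radius by at most [rho]. *)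
pose ep := Num.min (d / 2) (rho / (n%:R + 1)).
have ep0 : 0 < ep by rewrite lt_min !divr_gt0.
have epd : ep < d.
  by apply: (@le_lt_trans _ _ (d / 2)); [rewrite ge_min lexx|lra].
have nep : n%:R * ep <= rho.
  apply: (@le_trans _ _ ((n%:R + 1) * (rho / (n%:R + 1)))); last first.
    by rewrite mulrC divfK ?gt_eqF.
  apply: ler_pM => //; [exact: ltW|by rewrite lerDl|by rewrite ge_min lexx orbT].
exists (n%:R * (M / ep + 1)).
  by rewrite mulr_ge0// addr_ge0// divr_ge0// ltW.
move=> t /andP[t0 trho].
have [d2 d20 hd2] := uniform_continuity fc t0.
(* Enough translates for the spacing [eta] to be less than [d2], so that [f] oscillates by at most
   [t] at scale [eta]. *)
pose N := Num.truncn (ep / d2).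
pose eta := ep / N.+1%:R.
have eta0 : 0 < eta by rewrite divr_gt0.
have Nep : N.+1%:R * eta = ep by rewrite mulrC divfK// pnatr_eq0.
have etad : eta < d2.
  rewrite ltr_pdivrMr ?ltr0n// mulrC -ltr_pdivrMr//.
  by have /andP[] := truncn_itv (ltW (divr_gt0 ep0 d20)).
have fM h : increments z (3 * rho) f h [set w | enorm w <= M].
  by move=> x /ltW xz /ltW xhz; exact: hM.
have fom h : enorm h <= eta -> increments z (3 * rho) f h [set w | enorm w <= t].
  move=> heta x /ltW xz _; apply/ltW/hd2 => //.
  by rewrite addrAC subrr add0r (le_lt_trans heta).
have fka h : enorm h <= ep -> increments z (3 * rho) f h [set w | enorm w <= ka / (n%:R + 1)].
  move=> heta x /ltW xz _; apply/ltW/hd => //.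
  by rewrite addrAC subrr add0r (le_lt_trans heta).
have sz : size (enum 'I_n) = n by rewrite size_enum_ord.
have rr : 2 * rho <= 3 * rho - n%:R * ep by lra.
exists (averages eta N f (enum 'I_n)); split.
- move=> h C mC hf; have := averages_increments eta0 Nep (l := enum 'I_n) mC hf.
  rewrite sz => H x xs xhs; apply: H; exact: eball_le rr _ _.
- move=> x xz; have := averages_close eta0 Nep fka (l := enum 'I_n) (x := x).
  rewrite sz => /(_ _) /le_trans; apply; last first.
    rewrite mulrA ler_pdivrMr// mulrC ler_wpM2l ?lerDl// ltW//.
  by apply: eball_le rr _ _; rewrite /eball /=; lra.
- move=> x h xz ht.
  have := averages_lipschitz_all eta0 Nep M0 fM fom xz (le_lt_trans ht trho).
  move=> /(_ _) /le_trans; apply; first lra.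
  rewrite -[leRHS]mulrA; apply: ler_wpM2l => //; rewrite mulrDl mul1r lerD2r.
  by apply: ler_wpM2l => //; rewrite divr_ge0// ltW.
Qed.

(** If the minimum [mu] of [|f - y|] on the ball were positive, then at a minimizer [q] of [|F - y|]
    the vector [w = F q - y] would have norm at least [mu / 2]. With [u = w / |w|], the step to
    [q - t v] changes [|w|^2] by at most [- mu * delta * t + L^2 * t^2], which is negative. *)
Lemma hit : exists2 x, enorm (x - z) <= rho & f x = y.
Proof.
have fc1 x : enorm (x - z) <= rho -> {for x, continuous f}.
  by move=> xz; apply: fc; have := rho0; lra.
have [p pz pmin] := enorm_subr_min y (ltW rho0) fc1.
exists p => //; apply/eqP; rewrite -subr_eq0; apply/eqP/enorm_eq0/eqP.
rewrite eq_le enorm_ge0 andbT leNgt; apply/negP.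
set mu := enorm (f p - y) => mu0.
have dr0 : 0 < delta * rho by rewrite mulr_gt0.
(* The first bound keeps [|F - y|] at least [mu / 2] on the ball, the second keeps the minimizer of
   [|F - y|] away from the boundary. *)
pose ka := Num.min (mu / 2) (delta * rho / 32).
have ka0 : 0 < ka by rewrite lt_min !divr_gt0.
have ka1 : ka <= mu / 2 by rewrite ge_min lexx.
have ka2 : ka <= delta * rho / 32 by rewrite ge_min lexx orbT.
have [L L0 hL] := averaged_map ka0.
(* [rho / 2] keeps the moved point in the ball; the other bound makes the gain [mu * delta * t]
   exceed [L ^+ 2 * t ^+ 2], the [+ 1] allowing [L = 0]. *)
pose t := Num.min (rho / 2) (delta * mu / (2 * (L ^+ 2 + 1))).
have L1 : 0 < L ^+ 2 + 1 by rewrite ltr_wpDl// sqr_ge0.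
have t0 : 0 < t by rewrite lt_min !divr_gt0// mulr_gt0.
have t1 : t <= rho / 2 by rewrite ge_min lexx.
have t2 : t * (2 * (L ^+ 2 + 1)) <= delta * mu.
  by rewrite -ler_pdivlMr ?mulr_gt0// ge_min lexx orbT.
have [|F [Finc Fclose FL]] := hL t; first by rewrite t0 /=; lra.
have Fc x : enorm (x - z) <= rho -> {for x, continuous F}.
  move=> xz; apply/eball_continuousP => e e0.
  have e20 : 0 < e / 2 by rewrite divr_gt0.
  have [d d0 hd] := uniform_continuity fc e20.
  exists (Num.min d rho); first by rewrite lt_min d0.
  move=> w; rewrite /eball /= lt_min => /andP[wd wr].
  have H : increments z (3 * rho) f (w - x) [set w | enorm w <= e / 2].
    move=> a /ltW az _; apply/ltW/hd => //.
    by rewrite addrAC subrr add0r.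
  have := Finc _ _ (@mean_closed_enorm _ _ _) H x.
  rewrite [x + _]addrC subrK /= => H2.
  apply: le_lt_trans (H2 _ _) _; last lra.
    by rewrite /eball /=; lra.
  by rewrite /eball /=; have := enorm_triangle w x z; lra.
have [q qz qmin] := enorm_subr_min y (ltW rho0) Fc.
have Fmu : mu / 2 <= enorm (F q - y).
  have := pmin q qz; have := Fclose q qz; have := enorm_triangle (f q) (F q) y.
  rewrite (enormC (f q) (F q)) -/mu; lra.
have zz : enorm (z - z) <= rho by rewrite subrr enorm0 ltW.
(* [F] inherits the lower Lipschitz bound, so [delta * |q - z| <= |F q - y| + |F z - y| <= 2 * |F z
   - y|], which is less than [2 * (delta * rho / 8 + delta * rho / 32)]. *)
have qz2 : enorm (q - z) < rho / 2.
  have h1 := qmin z zz.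
  have h2 := Fclose z zz; have h3 := enorm_triangle (F z) (f z) y.
  have h4 := enorm_triangle (F q) y (F z); rewrite (enormC y (F z)) in h4.
  have h5 : delta * enorm (q - z) <= enorm (F q - F z).
    apply: (@grows_expands F z (2 * rho)) => [v v1||].
    - have [u u1 hu] := out v1; exists u => // a a0.
      by apply: Finc; [exact: mean_closed_dot|exact: hu].
    - by apply: eball_center; rewrite mulr_gt0.
    - by rewrite /eball /=; have := rho0; lra.
  rewrite -(ltr_pM2l delta0); have h6 := yz; clear -h1 h2 h3 h4 h5 h6 ka2 dr0; lra.
have [w wdef] : {w | w = F q - y} by exists (F q - y).
rewrite -wdef in Fmu.
have w0 : enorm w != 0 by rewrite gt_eqF//; lra.
have [u u1 wE] := normalize w0.
have [v v1 hv] := inw u1.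
have [d ddef] : {d | d = F (q - t *: v) - F q} by exists (F (q - t *: v) - F q).
have tv : enorm (t *: v) = t by rewrite enormZ v1 mulr1 gtr0_norm.
have qtz : enorm (q - t *: v - z) <= rho.
  by rewrite addrAC; apply: (le_trans (enormB _ _)); lra.
have h1 : delta * t <= - dot u d.
  rewrite -dotNr ddef opprB.
  have := Finc _ _ (@mean_closed_dot _ _ _ _) (hv t (ltW t0)) (q - t *: v).
  rewrite subrK; apply; rewrite /eball /=; have := rho0; lra.
have h2 : enorm d <= L * t by rewrite ddef; apply: FL; rewrite ?enormN ?tv.
have h3 := qmin _ qtz.
have E : F (q - t *: v) - y = w + d by rewrite wdef ddef [RHS]addrC addrA subrK.
rewrite -wdef E -(ler_pXn2r (n := 2)) ?nnegrE ?enorm_ge0// !enorm_sqr in h3.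
have wd : dot w d = enorm w * dot u d by rewrite {1}wE dotZl.
rewrite dotDl !dotDr (dotC d) -!enorm_sqr wd in h3.
have h4 : enorm d ^+ 2 <= L ^+ 2 * t ^+ 2.
  by rewrite -exprMn lerXn2r ?nnegrE ?enorm_ge0// mulr_ge0// ltW.
have h5 : mu / 2 * (delta * t) <= enorm w * - dot u d.
  by apply: ler_pM => //; rewrite ?mulr_ge0 ?divr_ge0// ltW.
have h6 : t * (t * (2 * (L ^+ 2 + 1))) <= t * (delta * mu) by rewrite ler_wpM2l// ltW.
have h7 : 0 < t ^+ 2 by rewrite exprn_gt0.
have h8 : 0 <= L ^+ 2 * t ^+ 2 by rewrite mulr_ge0 ?sqr_ge0.
have h9 : t * (t * (2 * (L ^+ 2 + 1))) = 2 * (L ^+ 2 * t ^+ 2) + 2 * t ^+ 2 by ring.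
lra.
Qed.

End Hit.

Lemma open_image f z r delta : 0 < delta ->
  (forall x, eball z r x -> {for x, continuous f}) ->
  (forall v, enorm v = 1 -> exists2 u, enorm u = 1 & grows f z r delta u v) ->
  (forall u, enorm u = 1 -> exists2 v, enorm v = 1 & grows f z r delta u v) ->
  open (f @` eball z r).
Proof.
move=> d0 fc out inw; apply/open_eballP => _ [x xB <-].
have [e e0 he] := open_eball (@eball_open _ _ z r) xB.
pose rho := e / 4; have rho0 : 0 < rho by rewrite divr_gt0.
have sub a : enorm (a - x) <= 3 * rho -> eball z r a.
  by move=> ax; apply: he; rewrite /eball /=; rewrite /rho in ax; lra.
have gr u v : grows f z r delta u v -> grows f x (3 * rho) delta u v.
  by move=> h t t0 a /ltW/sub aB /ltW/sub atB; exact: h.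
exists (delta * rho / 8); first by rewrite divr_gt0// mulr_gt0.
move=> y; rewrite /eball /= enormC => yx.
have [|||a ax <-] := hit rho0 d0 _ _ _ yx.
- by move=> a /sub/fc.
- by move=> v /out[u u1 /gr]; exists u.
- by move=> v /inw[u u1 /gr]; exists u.
- by exists a => //; apply: sub; apply: (le_trans ax); lra.
Qed.

End OpenImage.

(** * Regular points *)

Section RegularPoint.
Variables (R : realType).

Lemma conv_hull_sub (E : lmodType R) (A : set E) : A `<=` conv_hull A.
Proof. by move=> x Ax M [_]; apply. Qed.

Lemma conv_hull_convex (E : lmodType R) (A : set E) x y (t : R) :
  conv_hull A x -> conv_hull A y -> 0 <= t <= 1 -> conv_hull A ((1 - t) *: x + t *: y).
Proof.
move=> xA yA /andP[t0 t1] M MA.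
have := MA.1 y x (Itv01 t0 t1); rewrite !inE addrC.
by apply; [exact: yA MA|exact: xA MA].
Qed.

Variables (n : nat) (Omega : set 'rV[R]_n) (f : 'rV[R]_n -> 'rV[R]_n).

Lemma sigma_min_ge0 (A : 'M[R]_n) : (0 <= sigma_min A)%E.
Proof.
apply: le_ereal_inf_tmp => _ [v _ <-]; rewrite lee_fin; exact: sqrtr_ge0.
Qed.

Lemma enorm_mulmx_tr (A : 'M[R]_n) (v : 'rV[R]_n) : enorm (v *m A) = enorm (A^T *m v^T).
Proof. by rewrite -trmx_mul -(enorm_tr (v *m A)^T) trmxK. Qed.

Lemma sigma_min_expands (A : 'M[R]_n) (d : R) :
  (d%:E <= sigma_min A)%E -> expands d A^T.
Proof.
move=> dA v; have [e0|e0] := eqVneq (enorm v) 0; first by rewrite e0 mulr0 enorm_ge0.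
have [w w1 vE] := normalize e0.
rewrite vE -scalemxAl !enormZ w1 mulr1 ger0_norm ?enorm_ge0// mulrC.
rewrite ler_wpM2l ?enorm_ge0// -lee_fin; apply: (le_trans dA).
apply: ereal_inf_lbound; exists w^T; last by rewrite enorm_mulmx_tr trmxK.
by rewrite /= -enorm_tr trmxK.
Qed.

Lemma regular_point_expands x : open Omega -> regular_point Omega f x ->
  exists r d, [/\ 0 < r, 0 < d, eball x r `<=` Omega &
    forall A, conv_hull (deriv_image Omega f (eball x r)) A -> expands d A^T].
Proof.
move=> oO [Ox nu0]; have [e e0 he] := open_eball oO Ox.
pose g (r : R) := ereal_inf
  [set sigma_min A | A in conv_hull (deriv_image Omega f (eball x r))].
have g0 r : (0 <= g r)%E.
  by apply: le_ereal_inf_tmp => _ [A _ <-]; exact: sigma_min_ge0.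
have [r [r0 re gr]] : exists r, [/\ 0 < r, r < e & (0 < g r)%E].
  apply: contrapT => /forallNP H; move: nu0; rewrite /nu (_ : lim _ = 0%E) ?ltxx//.
  apply: lim_near_cst => //; near=> r.
  apply/eqP; rewrite eq_le g0 andbT leNgt; apply/negP => gr.
  by apply: (H r); split => //; near: r; exact: nbhs_right_lt.
have [d d0 dg] : exists2 d : R, 0 < d & (d%:E <= g r)%E.
  case: (g r) gr => [d| |] //= gr; first by exists d.
  (* The infimum may be infinite, as in dimension 0, where there is no unit vector; any positive
     constant then serves. *)
  by exists 1; rewrite ?leey.
exists r, d; split => //.
  by apply: subset_trans he; apply: eball_le; exact: ltW.
move=> A CA; apply: sigma_min_expands; apply: (le_trans dg).
by apply: ereal_inf_lbound; exists A.
Unshelve. all: by end_near. Qed.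

End RegularPoint.

Theorem theorem4p2 (R : realType) (D : forall n : nat, set (set 'rV[R]_n))
    (hD : o_minimal D) (n : nat) (Omega : set 'rV[R]_n)
    (f : 'rV[R]_n -> 'rV[R]_n) (xbar : 'rV[R]_n)
    (Omega_open : open Omega) (Omega_def : D n Omega)
    (f_cont : {within Omega, continuous f}) (f_def : definable_map D Omega f)
    (xbar_reg : regular_point Omega f xbar) :
  exists r delta : R,
    [/\ 0 < r, 0 < delta, eball xbar r `<=` Omega,
      forall x x', eball xbar r x -> eball xbar r x' ->
        delta * enorm (x' - x) <= enorm (f x' - f x) &
      open (f @` eball xbar r) /\
      exists g : 'rV[R]_n -> 'rV[R]_n,
        [/\ homeomorphism_with_inverse (eball xbar r) (f @` eball xbar r) f g,
          elipschitz_on (f @` eball xbar r) g &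
          definable_map D (f @` eball xbar r) g]].
Proof.
have [r [d [r0 d0 BO hC]]] := regular_point_expands Omega_open xbar_reg.
set C := conv_hull _ in hC.
set B := eball xbar r in BO *.
(* Extension by 0 outside [Omega], total and definable. *)
pose f0 x := if pselect (Omega x) then f x else 0.
have df0 : definable_tmap D f0.
  rewrite /definable_tmap.
  have -> : [set z : 'rV[R]_(n + n) | rsubmx z = f0 (lsubmx z)] =
      [set z | [set row_mx x (f x) | x in Omega] z \/
        (~ Omega (lsubmx z) /\ forall j, rsubmx z 0 j = 0)].
    apply/seteqP; split => z /=; rewrite /f0.
      case: pselect => /= [Oz zE|nOz zE]; last by right; split => // j; rewrite zE mxE.
      by left; exists (lsubmx z) => //; rewrite -zE hsubmxK.
    move=> [[x Ox <-]|[nOz z0]].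
      by rewrite row_mxKl row_mxKr; case: pselect.
    by case: pselect => /= [//|_]; apply/rowP => j; rewrite z0 mxE.
  have dO : D (n + n)%N [set z | Omega (lsubmx z)].
    by apply: (definable_preim hD (h := lsubmx)) => //; definability hD.
  by definability hD.
have ff0 x : Omega x -> f x = f0 x by rewrite /f0; case: pselect.
have fc x : Omega x -> {for x, continuous f}.
  by move=> Ox; move: f_cont; rewrite continuous_open_subspace// => h; apply: h; rewrite inE.
have fcB x : B x -> {for x, continuous f} by move=> /BO/fc.
have growth (u v : 'rV[R]_n) : (forall A, C A -> d <= dot u (v *m A^T)) -> grows f xbar r d u v.
  move=> hA t t0 x xB xtB /=.
  apply: (directional_growth hD df0 (fun x xB => ff0 x (BO x xB)) fcB) => // y yB yC1.
  rewrite -[jacobian f y]trmxK; apply: hA; apply: conv_hull_sub.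
  by exists y => //; split; [split => //; exact: BO|move=> -[]].
have CT A B' t : C A -> C B' -> 0 <= t <= 1 -> C ((1 - t) *: A + t *: B').
  exact: conv_hull_convex.
(* The elements of [C] act on columns, as transposes of Jacobians do, whereas increments are rows:
   [out] therefore separates the transposes. For [inw] the roles of [u] and [v] are exchanged and
   [C] itself is separated, by means of [expands_tr]. *)
have out (v : 'rV[R]_n) : enorm v = 1 -> exists2 u, enorm u = 1 & grows f xbar r d u v.
  move=> v1; have [||u u1 hu] := @unit_separation_mx _ _ [set A^T | A in C] d d0 _ _ v v1.
  - move=> _ _ t [A CA <-] [A' CA' <-] t01; exists ((1 - t) *: A + t *: A'); first exact: CT.
    by rewrite linearD !linearZ.
  - by move=> _ [A CA <-]; exact: hC.
  by exists u => //; apply: growth => A CA; apply: hu; exists A.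
have inw (u : 'rV[R]_n) : enorm u = 1 -> exists2 v, enorm v = 1 & grows f xbar r d u v.
  move=> u1; have [||v v1 hv] := @unit_separation_mx _ _ C d d0 _ _ u u1; first exact: CT.
    by move=> A CA; rewrite -[A]trmxK; apply: expands_tr => //; exact: hC.
  by exists v => //; apply: growth => A CA; rewrite dotC -dot_mulmx; exact: hv.
have lip := grows_expands out.
have oB := open_image d0 fcB out inw.
exists r, d; split => //; split => //.
have inj x y : B x -> B y -> f x = f y -> x = y.
  move=> Bx By fxy; apply/eqP; rewrite -subr_eq0; apply/eqP/enorm_eq0/eqP.
  rewrite eq_le enorm_ge0 andbT -(pmulr_rle0 _ d0); apply: (le_trans (lip _ _ By Bx)).
  by rewrite fxy subrr enorm0.
pose g y := xget 0 [set x | B x /\ f x = y].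
have gK x : B x -> g (f x) = x.
  move=> Bx; have [Bg fg] := xgetPex 0 (P := [set x' | B x' /\ f x' = f x])
    (ex_intro _ x (conj Bx erefl)).
  exact: inj.
have glip y y' : (f @` B) y -> (f @` B) y' -> enorm (g y - g y') <= d^-1 * enorm (y - y').
  move=> [x Bx <-] [x' Bx' <-]; rewrite !gK// mulrC ler_pdivlMr// mulrC.
  exact: lip.
exists g; split.
- split => //.
  + split.
    * by move=> x Bx; exists x.
    * by move=> x y; rewrite !inE => Bx By; exact: inj.
    * by move=> y [x Bx <-]; exists x.
  + by rewrite continuous_open_subspace; [move=> x; rewrite inE; exact: fcB|exact: eball_open].
  + rewrite continuous_open_subspace// => y; rewrite inE => yB.
    apply/eball_continuousP => e e0; have [k k0 hk] := open_eball oB yB.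
    exists (Num.min k (d * e)); first by rewrite lt_min k0 mulr_gt0.
    move=> w; rewrite /eball /= lt_min => /andP[/hk wB wd].
    by apply: (le_lt_trans (glip _ _ wB yB)); rewrite mulrC ltr_pdivrMr// mulrC.
- by exists d^-1.
- rewrite /definable_map.
  (* The graph of the inverse is the graph of [f] over the ball with its two factors exchanged,
     written with [f0] so as to be a formula. *)
  have -> : [set row_mx y (g y) | y in f @` B] =
      [set z | enorm (rsubmx z - xbar) < r /\ forall j, lsubmx z 0 j = f0 (rsubmx z) 0 j].
    apply/seteqP; split => z /=.
      move=> [_ [x Bx <-] <-]; rewrite row_mxKl row_mxKr gK//.
      by split => // j; rewrite ff0//; exact: BO.
    move=> [Bz zE]; exists (lsubmx z); last first.
      have -> : g (lsubmx z) = rsubmx z; last by rewrite hsubmxK.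
      have -> : lsubmx z = f (rsubmx z); last exact: gK.
      by rewrite (ff0 _ (BO _ Bz)); apply/rowP.
    exists (rsubmx z) => //; rewrite (ff0 _ (BO _ Bz)); apply/esym; exact/rowP.
  by definability hD.
Qed.
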